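(* Let $X$ be an $L$-space, $\omega$ a concave modulus of continuity, and let $n\in\mathbb N$, $h>0$ be such that there exist vectors ${\bf t}=(t_1,\dots,t_n)$ satisfying $$a\le t_1-h<t_1+h<t_2-h<\dots<t_n+h\le b.\qquad( * )$$ For such ${\bf t}$ let $$I_{\bf t}(f)=\left(\frac1{2h}\int_{t_1-h}^{t_1+h}f(t)\,dt,\dots,\frac1{2h}\int_{t_n-h}^{t_n+h}f(t)\,dt\right),$$ and let $\Lambda(f)=\int_a^bf(t)\,dt$. Then $$\inf_{\bf t}\mathcal E(\Lambda,H^\omega([a,b],X),I_{\bf t},X)=2n\left(1-\frac{2nh}{b-a}\right)\int_0^{(b-a)/(2n)}\omega(t)\,dt,$$ where the infimum is over all ${\bf t}$ satisfying $( * )$. The optimal information operator is $I_{{\bf t}^*}$, where ${\bf t}^*=(t_1^*,\dots,t_n^* )$, $t_k^*=a+\frac{(2k-1)(b-a)}{2n}$, and the optimal recovery method is $$\Phi^*(I_{{\bf t}^*}(f))=\frac{b-a}n\sum_{k=1}^n\frac1{2h}\int_{t_k^*-h}^{t_k^*+h}f(t)\,dt;$$ that is, the error $\mathcal E(\Lambda,H^\omega([a,b],X),I_{{\bf t}^*},\Phi^*,X)$ equals $2n\left(1-\frac{2nh}{b-a}\right)\int_0^{(b-a)/(2n)}\omega(t)\,dt$.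
   Context: A modulus of continuity is a non-decreasing continuous semi-additive function $\omega\colon[0,\infty)\to[0,\infty)$ (i.e. $\omega(s+t)\le\omega(s)+\omega(t)$) with $\omega(0)=0$. A semilinear space is a set $X$ with addition and multiplication by real numbers such that for all $x,y,z\in X$, $\alpha,\beta\in\mathbb R$: $x+y=y+x$; $x+(y+z)=(x+y)+z$; there is $\theta\in X$ with $x+\theta=x$ for all $x$; $\alpha(x+y)=\alpha x+\alpha y$; $\alpha(\beta x)=(\alpha\beta)x$; $1\cdot x=x$, $0\cdot x=\theta$. An $L$-space is a semilinear space $X$ with a complete separable metric $h_X$ such that $h_X(\alpha x,\alpha y)=|\alpha|h_X(x,y)$ and $h_X(x+z,y+z)\le h_X(x,y)$. An element $x$ is convex if $(\alpha+\beta)x=\alpha x+\beta x$ for all $\alpha,\beta\ge0$; $X^{\rm c}$ is the set of convex elements. An element $x$ is invertible if there is $x'\in X$ with $x+x'=\theta$; $X^{\rm inv}$ is the set of invertible elements. Standing assumption: $X^{\rm inv}\cap X^{\rm c}\ne\{\theta\}$. $X$ is equipped with a fixed convexifying operator $P$: a surjection $P\colon X\to X^{\rm c}$ with $h_X(P(x),P(y))\le h_X(x,y)$, $P\circ P=P$, $P(\alpha x+\beta y)=\alpha P(x)+\beta P(y)$ for all $x,y\in X$, $\alpha,\beta\in\mathbb R$. Integral: for a simple mapping $f$ taking values $f_1,\dots,f_n$ on pairwise disjoint measurable sets $T_1,\dots,T_n$, $\int f(s)\,ds:=\sum_iP(f_i)\mu(T_i)$ ($\mu$ the Lebesgue measure);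 for a uniform limit $f$ of simple mappings $f^k$ (in particular for continuous $f$), $\int f:=\lim_k\int f^k$. $H^\omega([a,b],X)$ is the class of $f\colon[a,b]\to X$ with $h_X(f(t'),f(t''))\le\omega(|t'-t''|)$ for all $t',t''\in[a,b]$. Optimal recovery: given a metric space $(E,h_E)$, sets $Z,Y$, a class $W\subset Z$, and mappings $\Lambda\colon Z\to E$, $I\colon W\to Y$, a method of recovery is an arbitrary mapping $\Phi\colon Y\to E$; $\mathcal E(\Lambda,W,I,\Phi,E)=\sup_{z\in W}h_E(\Lambda(z),\Phi(I(z)))$ and $\mathcal E(\Lambda,W,I,E)=\inf_\Phi\mathcal E(\Lambda,W,I,\Phi,E)$. Here $\Phi\colon X^n\to X$. *)

(* Defs.v *)
From HB Require Import structures.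
From mathcomp Require Import all_boot all_order all_algebra.
From mathcomp Require Import all_classical all_reals all_analysis.

Set Implicit Arguments.
Unset Strict Implicit.
Unset Printing Implicit Defensive.

Import Order.TTheory GRing.Theory Num.Theory.
Import numFieldNormedType.Exports.

Local Open Scope classical_set_scope.
Local Open Scope ring_scope.

(* The addition is not that of nmodType because the analysis library leaves no
   room for a join of nmodType and metricType. The scalar multiplication is not
   that of lSemiModType because
   (alpha + beta) x = alpha x + beta x is not assumed, even for
   alpha, beta >= 0. *)
HB.mixin Record isSemilinear (R : realType) (X : Type) := {
  stheta : X ;
  sadd : X -> X -> X ;
  sscale : R -> X -> X ;
  saddC : forall x y, sadd x y = sadd y x ;
  saddA : forall x y z, sadd x (sadd y z) = sadd (sadd x y) z ;
  sadds0 : forall x, sadd x stheta = x ;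
  sscaleDr : forall a x y, sscale a (sadd x y) = sadd (sscale a x) (sscale a y) ;
  sscaleA : forall a b x, sscale a (sscale b x) = sscale (a * b) x ;
  sscale1 : forall x, sscale 1 x = x ;
  sscale0 : forall x, sscale 0 x = stheta
}.

#[short(type="semilinearType")]
HB.structure Definition Semilinear (R : realType) := { X of isSemilinear R X }.

Arguments stheta {R s}.

Notation "x +s y" := (sadd x y)
  (at level 50, left associativity, format "x  +s  y") : ring_scope.
Notation "a *s x" := (sscale a x)
  (at level 40, left associativity, format "a  *s  x") : ring_scope.
Notation "\ssum_ ( i < n ) F" := (\big[sadd/stheta]_(i < n) F)
  (at level 41, F at level 41, i, n at level 50,
   format "\ssum_ ( i  <  n )  F") : ring_scope.

Section semilinear_monoid.
Context {R : realType} {X : semilinearType R}.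

Let sadd0s : left_id stheta (@sadd R X).
Proof. by move=> x; rewrite saddC sadds0. Qed.

HB.instance Definition _ := Monoid.isComLaw.Build X stheta (@sadd R X)
  (@saddA R X) (@saddC R X) sadd0s.

End semilinear_monoid.

HB.mixin Record isLSpace (R : realType) X
    & Semilinear R X & Metric R X & Complete X := {
  separable_lspace : exists2 D : set X, countable D & dense D ;
  mdist_sscale : forall (a : R) (x y : X),
    mdist (a *s x) (a *s y) = `|a| * mdist x y ;
  le_mdist_sadd : forall x y z : X, mdist (x +s z) (y +s z) <= mdist x y
}.

#[short(type="lspaceType")]
HB.structure Definition LSpace (R : realType) :=
  { X of Semilinear R X & Metric R X & Complete X & isLSpace R X }.

Section lspace.
Context {R : realType} {X : lspaceType R}.
Implicit Types (x : X) (P : X -> X) (f : R -> X).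

Definition convex_elt : set X :=
  [set x | forall a b : R, 0 <= a -> 0 <= b -> (a + b) *s x = a *s x +s b *s x].

Definition invertible_elt : set X := [set x | exists x' : X, x +s x' = stheta].

Record convexifying (P : X -> X) : Prop := {
  range_convexifying : range P = convex_elt ;
  convexifying_le : forall x y, mdist (P x) (P y) <= mdist x y ;
  convexifying_idem : forall x, P (P x) = P x ;
  convexifying_linear : forall (a b : R) x y,
    P (a *s x +s b *s y) = a *s P x +s b *s P y
}.

(* The sets T i are Lebesgue measurable: they belong to the Caratheodory
   sigma-algebra, on which completed_lebesgue_measure is defined. *)
Definition simple_integral P (D : set R) f (v : X) : Prop :=
  exists (m : nat) (T : 'I_m -> set R) (c : 'I_m -> X),
  [/\ forall i, ((wlength idfun)^*)%mu.-cara.-measurable (T i),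
      trivIset setT T,
      \bigcup_i T i = D,
      forall i s, T i s -> f s = c i
    & v = \ssum_(i < m) fine (completed_lebesgue_measure (T i)) *s P (c i)].

Definition is_integral P (D : set R) f (v : X) : Prop :=
  exists (g : nat -> R -> X) (w : nat -> X),
  [/\ forall k, simple_integral P D (g k) (w k),
      {uniform D, g @ \oo --> f}
    & w @ \oo --> v].

(* theta when f is not a uniform limit on D of simple mappings. *)
Definition Xintegral P (D : set R) f : X := xget stheta (is_integral P D f).

(* A mapping [a, b] -> X is represented by a mapping R -> X of which only the
   values on [a, b] are used. *)
Definition Hclass (omega : R -> R) (a b : R) : set (R -> X) :=
  [set f | forall t' t'' : R, t' \in `[a, b] -> t'' \in `[a, b] ->
    mdist (f t') (f t'') <= omega `|t' - t''|].

Definition mean_info P (h : R) (n : nat) (t : 'I_n -> R) f : 'I_n -> X :=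
  fun k => (2 * h)^-1 *s Xintegral P `[t k - h, t k + h] f.

Definition mean_method (a b : R) (n : nat) (y : 'I_n -> X) : X :=
  ((b - a) / n%:R) *s \ssum_(k < n) y k.

End lspace.

Arguments mean_method {R X} a b n y.
Arguments mean_info {R X} P h n t f.

Section reals.
Context {R : realType}.

Record modulus_of_continuity (omega : R -> R) : Prop := {
  modulus_ge0 : forall t, 0 <= t -> 0 <= omega t ;
  modulus0 : omega 0 = 0 ;
  modulus_nondecreasing : forall s t, 0 <= s -> s <= t -> omega s <= omega t ;
  modulus_continuous : {within `[0, +oo[, continuous omega} ;
  modulus_semiadditive : forall s t, 0 <= s -> 0 <= t ->
    omega (s + t) <= omega s + omega t
}.

Definition concave_on (D : set R^o) (omega : R^o -> R^o) : Prop :=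
  convex_function D (fun t => - omega t).

(* a <= t_1 - h < t_1 + h < t_2 - h < ... < t_n + h <= b, for h > 0 and n >= 1;
   t_1, ..., t_n is indexed from 0. *)
Definition admissible (a b h : R) (n : nat) (t : 'I_n -> R) : Prop :=
  [/\ forall i : 'I_n, i = 0%N :> nat -> a <= t i - h,
      forall i j : 'I_n, j = i.+1 :> nat -> t i + h < t j - h
    & forall i : 'I_n, i.+1 = n -> t i + h <= b].

Definition midpoints (a b : R) (n : nat) : 'I_n -> R :=
  fun k => a + (2 * k.+1%:R - 1) * (b - a) / (2 * n%:R).

End reals.

Arguments midpoints {R} a b n k.
Arguments admissible {R} a b h n t.

Section optimal_recovery.
Context {R : realType} {Z Y : Type} {E : metricType R}.
Local Open Scope ereal_scope.

Definition method_error (Lambda : Z -> E) (W : set Z) (I : Z -> Y)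
    (Phi : Y -> E) : \bar R :=
  ereal_sup [set (mdist (Lambda z) (Phi (I z)))%:E | z in W].

Definition recovery_error (Lambda : Z -> E) (W : set Z) (I : Z -> Y) : \bar R :=
  ereal_inf (range (method_error Lambda W I)).

End optimal_recovery.

(* Main.v *)
(* Upper bound. Let d = (b - a) / 2n and p = h / d, and split [a, b] into n cells
   of half-length d centred at the nodes. On a half-cell the method replaces the
   integral of f over the outer part, at distance between h and d of the node, by
   (1 - p) / p times its integral over the inner part. Sending the point at
   distance h + (1 - p) x to the point at distance h - p x transports one measure
   to the other and moves points by x, whence an error of at most (1 - p) times
   the integral of omega over [0, d].

   Lower bound. A nonzero invertible convex element spans an isometric copy of
   the real line. Let phi(s) = psi(dist(s, {t_k}) - h), where psi(x) =
   (1 - p) omega(x / (1 - p)) for x >= 0 and psi(x) = - p omega(- x / p) for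
   x <= 0. Concavity gives phi the modulus omega, the means of phi over the
   intervals [t_k - h, t_k + h] all have the same value, which can be subtracted,
   and the integral of phi over [a, b] is least for equal cells. The resulting
   function and its opposite have the same information. *)

Require Import Defs.
From mathcomp Require Import all_boot all_order all_algebra.
From mathcomp Require Import all_classical all_reals all_analysis.
From mathcomp Require Import ring lra.

Set Implicit Arguments.
Unset Strict Implicit.
Unset Printing Implicit Defensive.

Import Order.TTheory GRing.Theory Num.Theory.
Import numFieldNormedType.Exports.

Local Open Scope classical_set_scope.
Local Open Scope ring_scope.

Notation lmeasurable := (((wlength idfun)^*)%mu.-cara.-measurable).
Notation lmeas A := (fine (completed_lebesgue_measure A)).

(** * Integrals of mappings into an L-space *)

Section lmeas.
Context {R : realType}.
Implicit Types (A D : set R).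

Lemma lmeasurable_itv (i : interval R) : lmeasurable [set` i].
Proof. apply: sub_caratheodory; exact: measurable_itv. Qed.

Lemma lmeas_set1 (c : R) : lmeas [set c] = 0.
Proof.
rewrite -[completed_lebesgue_measure _]/(lebesgue_measure [set c]).
by rewrite lebesgue_measure_set1.
Qed.

Lemma lmeas_itvoc (x y : R) : x <= y -> lmeas `]x, y] = y - x.
Proof.
move=> xy; rewrite -[completed_lebesgue_measure _]/(lebesgue_measure `]x, y]%classic).
rewrite lebesgue_measure_itv/= lte_fin.
by move: xy; rewrite le_eqVlt => /predU1P[->|->]; rewrite ?ltxx ?subrr// -EFinB.
Qed.

Lemma lmeas_ge0 A : 0 <= lmeas A.
Proof. by rewrite fine_ge0. Qed.

Lemma lmeas_bigcup n (T : 'I_n -> set R) A :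
  lmeasurable A -> (completed_lebesgue_measure A < +oo)%E ->
  (forall i, lmeasurable (T i)) -> trivIset setT T -> A `<=` \bigcup_i T i ->
  lmeas A = \sum_(i < n) lmeas (A `&` T i).
Proof.
move=> mA Aoo mT tT AT.
have mAT i : lmeasurable (A `&` T i) by exact: measurableI.
rewrite sum_fine; last first.
  move=> i _; rewrite ge0_fin_numE//; apply: le_lt_trans Aoo.
  by rewrite le_measure ?inE//; exact: subIsetl.
congr fine; rewrite -measure_bigsetU_ord//; last exact: trivIset_setIl.
congr completed_lebesgue_measure.
rewrite -bigcup_seq -setI_bigcupr; apply/seteqP; split => x; last by case.
move=> Ax; split => //; have [i _ Tix] := AT _ Ax; exists i => //=.
by rewrite mem_index_enum.
Qed.

End lmeas.

Section semilinear.
Context {R : realType} {X : lspaceType R}.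
Implicit Types (x y z : X) (P : X -> X).

Lemma sscales0 (a : R) : a *s (stheta : X) = stheta.
Proof. by rewrite -(sscale0 (stheta : X)) sscaleA mulr0 sscale0. Qed.

Lemma sadd0s x : stheta +s x = x.
Proof. by rewrite saddC sadds0. Qed.

Lemma saddACA : interchange (@sadd R X) sadd.
Proof. by move=> x y z t; rewrite -!saddA (saddA y) (saddC y) -(saddA z). Qed.

Lemma sscale_sumr (a : R) n (F : 'I_n -> X) :
  a *s (\ssum_(i < n) F i) = \ssum_(i < n) (a *s F i).
Proof.
apply: (big_morph (fun x => a *s x)); last exact: sscales0.
by move=> x y; rewrite sscaleDr.
Qed.

Lemma le_mdist_sadd2 x y z t : mdist (x +s y) (z +s t) <= mdist x z + mdist y t.
Proof.
apply: le_trans (metric_triangle _ (z +s y) _) _; rewrite lerD ?le_mdist_sadd//.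
by rewrite !(saddC z) le_mdist_sadd.
Qed.

Lemma le_mdist_sum n (F G : 'I_n -> X) :
  mdist (\ssum_(i < n) F i) (\ssum_(i < n) G i) <=
  \sum_(i < n) mdist (F i) (G i).
Proof.
elim/big_rec3 : _ => [|i t x y _ le_xy]; first by rewrite mdistxx.
by apply: le_trans (le_mdist_sadd2 _ _ _ _) _; rewrite lerD2l.
Qed.

Lemma mdist_sscale_ge0 (a : R) x y : 0 <= a ->
  mdist (a *s x) (a *s y) = a * mdist x y.
Proof. by move=> a0; rewrite mdist_sscale ger0_norm. Qed.

Lemma sscale_suml x n (F : 'I_n -> R) : convex_elt x ->
  (forall i, 0 <= F i) -> (\sum_(i < n) F i) *s x = \ssum_(i < n) (F i *s x).
Proof.
move=> cx F0.
(* Convexity of [x] splits only nonnegative scalars, so the induction also carries the sign of the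
   partial sum. *)
suff [] : (\sum_(i < n) F i) *s x = \ssum_(i < n) (F i *s x) /\ 0 <= \sum_(i < n) F i by [].
elim/big_rec2 : _ => [|i y a _ [<- a0]]; first by rewrite sscale0.
by rewrite cx// addr_ge0.
Qed.

(** Translation by [z] contracts distances, and so does the translation by its inverse that undoes
    it. *)
Lemma invertible_isometry x y z : invertible_elt z ->
  mdist (x +s z) (y +s z) = mdist x y.
Proof.
move=> [z' zz']; apply/eqP; rewrite eq_le le_mdist_sadd/=.
by rewrite -{1}(sadds0 x) -{1}(sadds0 y) -zz' !saddA le_mdist_sadd.
Qed.

Context {P : X -> X}.
Hypothesis Pc : convexifying P.

Lemma convexifying_theta : P stheta = stheta.
Proof.
have := convexifying_linear Pc 0 0 stheta stheta.
by rewrite !sscale0 !sadds0.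
Qed.

Lemma convexifyingD x y : P (x +s y) = P x +s P y.
Proof. by have := convexifying_linear Pc 1 1 x y; rewrite !sscale1. Qed.

Lemma convexifyingZ a x : P (a *s x) = a *s P x.
Proof.
by have := convexifying_linear Pc a 0 x x; rewrite !sscale0 !sadds0.
Qed.

Lemma convex_convexifying x : convex_elt (P x).
Proof. by rewrite -(range_convexifying Pc); exists x. Qed.

Lemma convexifying_id x : convex_elt x -> P x = x.
Proof.
by rewrite -(range_convexifying Pc) => -[y _ <-]; rewrite convexifying_idem.
Qed.

Lemma convexifying_sum n (F : 'I_n -> X) :
  P (\ssum_(i < n) F i) = \ssum_(i < n) P (F i).
Proof. exact: (big_morph P convexifyingD convexifying_theta). Qed.

End semilinear.

(** * Simple mappings uniformly close to a given mapping *)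

Section approx.
Context {R : realType} {X : lspaceType R} {P : X -> X}.
Hypothesis Pc : convexifying P.
Implicit Types (D : set R) (f g : R -> X) (v w : X) (e : R).

(** Estimates are made on such values rather than on limits of sequences: [v] determines the
    integral up to [e * lmeas D]. *)
Definition approx_integral D f e v :=
  exists2 g, simple_integral P D g v & forall s, D s -> mdist (g s) (f s) <= e.

Lemma simple_integral_measurable D g v : simple_integral P D g v -> lmeasurable D.
Proof.
move=> [m [T [c [mT _ <- _ _]]]].
by apply: fin_bigcup_measurable => //; exact: finite_finset.
Qed.

Lemma approx_convex D f e v : approx_integral D f e v -> convex_elt v.
Proof.
move=> [g [m [T [c [_ _ _ _ ->]]]] _].
under eq_bigr do rewrite -(convexifyingZ Pc).
rewrite -(convexifying_sum Pc); exact: convex_convexifying.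
Qed.

(** Both sums are rewritten over the common refinement of [T] and [T']; the measures can be
    distributed because values of [P] are convex. *)
Lemma simple_integral_dist D f g v w e :
  (completed_lebesgue_measure D < +oo)%E ->
  simple_integral P D f v -> simple_integral P D g w ->
  (forall s, D s -> mdist (f s) (g s) <= e) -> mdist v w <= e * lmeas D.
Proof.
move=> Doo If Ig fg; have mD := simple_integral_measurable If.
case: If => m [T [c [mT tT TD fT ->]]].
case: Ig => m' [T' [c' [mT' tT' T'D gT' ->]]].
have Too i : (completed_lebesgue_measure (T i) < +oo)%E.
  apply: le_lt_trans Doo; rewrite le_measure ?inE// -TD.
  exact: bigcup_sup.
have T'oo i : (completed_lebesgue_measure (T' i) < +oo)%E.
  apply: le_lt_trans Doo; rewrite le_measure ?inE// -T'D.
  exact: bigcup_sup.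
under eq_bigr => i _.
  rewrite (lmeas_bigcup (mT i) (Too i) mT' tT'); last first.
    by rewrite T'D -TD; exact: bigcup_sup.
  rewrite sscale_suml; [|exact: convex_convexifying|by move=> ?; exact: lmeas_ge0].
  over.
under [X in mdist _ X]eq_bigr => j _.
  rewrite (lmeas_bigcup (mT' j) (T'oo j) mT tT); last first.
    by rewrite TD -T'D; exact: bigcup_sup.
  rewrite sscale_suml; [|exact: convex_convexifying|by move=> ?; exact: lmeas_ge0].
  over.
rewrite [X in mdist _ X]exchange_big/=.
rewrite (lmeas_bigcup mD Doo mT tT) ?TD// mulr_sumr.
apply: le_trans (le_mdist_sum _ _) _; apply: ler_sum => i _.
have TiD : T i `<=` D by rewrite -TD; exact: bigcup_sup.
rewrite (setIidr TiD).
rewrite (lmeas_bigcup (mT i) (Too i) mT' tT') ?T'D// mulr_sumr.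
apply: le_trans (le_mdist_sum _ _) _; apply: ler_sum => j _.
rewrite (setIC (T' j)) mdist_sscale_ge0 ?lmeas_ge0// mulrC.
(* An empty piece has measure 0; a point of a nonempty one exhibits [c i] and [c' j] as values of
   [f] and [g]. *)
have [->|/set0P[s [Ts T's]]] := eqVneq (T i `&` T' j) set0.
  by rewrite measure0/= !mulr0.
rewrite ler_wpM2r ?lmeas_ge0//; apply: le_trans (convexifying_le Pc _ _) _.
by rewrite -(fT _ _ Ts) -(gT' _ _ T's) fg//; exact: TiD.
Qed.

Lemma approx_dist D f v w e e' :
  (completed_lebesgue_measure D < +oo)%E ->
  approx_integral D f e v -> approx_integral D f e' w ->
  mdist v w <= (e + e') * lmeas D.
Proof.
move=> Doo [g gv gf] [g' gw gf']; apply: simple_integral_dist gv gw _ => // s Ds.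
apply: le_trans (metric_triangle _ (f s) _) _.
by rewrite lerD ?gf// metric_sym gf'.
Qed.

Lemma approx_setU D1 D2 f v w e : D1 `&` D2 = set0 ->
  approx_integral D1 f e v -> approx_integral D2 f e w ->
  approx_integral (D1 `|` D2) f e (v +s w).
Proof.
move=> D12 [g [m [T [c [mT tT TD gT ->]]]] gf].
move=> [g' [m' [T' [c' [mT' tT' T'D gT' ->]]]] gf'].
have nD s : D2 s -> ~ D1 s.
  by move=> D2s D1s; have : (D1 `&` D2) s by []; rewrite D12.
have TD1 i s : T i s -> D1 s by rewrite -TD => Ts; exists i.
have TD2 i s : T' i s -> D2 s by rewrite -T'D => Ts; exists i.
exists (fun s => if s \in D1 then g s else g' s); last first.
  move=> s [D1s|D2s]; first by rewrite mem_set// gf.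
  by rewrite memNset ?gf'//; exact: nD.
exists (m + m')%N.
exists (fun k : 'I_(m + m') =>
  match fintype.split k with inl i => T i | inr j => T' j end).
exists (fun k : 'I_(m + m') =>
  match fintype.split k with inl i => c i | inr j => c' j end).
split.
- by move=> k; case: fintype.split.
- apply/trivIsetP => k l _ _ /= kl.
  have : fintype.split k != fintype.split l :> 'I_m + 'I_m'.
    by apply: contra kl => /eqP kl; rewrite -(fintype.splitK k) kl fintype.splitK.
  case: (fintype.split k) => i; case: (fintype.split l) => j ij; apply/seteqP; split => // s [].
  + move=> Ti Tj; move/trivIsetP : tT => /(_ i j I I) TT.
    by rewrite -TT//; apply: contra ij => /eqP ->.
  + by move=> /TD1 D1s /TD2 /nD.
  + by move=> /TD2 /nD nD1 /TD1.
  + move=> Ti Tj; move/trivIsetP : tT' => /(_ i j I I) TT.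
    by rewrite -TT//; apply: contra ij => /eqP ->.
- rewrite -TD -T'D; apply/seteqP; split => s.
    by move=> [k _]; case: fintype.split => i Ts; [left|right]; exists i.
  move=> [[i _ Ts]|[i _ Ts]].
    exists (lshift m' i) => //.
    by rewrite -[lshift _ _]/(fintype.unsplit (inl i)) fintype.unsplitK.
  exists (rshift m i) => //.
  by rewrite -[rshift _ _]/(fintype.unsplit (inr i)) fintype.unsplitK.
- move=> k s; case: fintype.split => i Ts.
    by rewrite (mem_set (TD1 _ _ Ts)) (gT _ _ Ts).
  by rewrite (memNset (nD _ (TD2 _ _ Ts))) (gT' _ _ Ts).
- rewrite big_split_ord/=; congr (_ +s _); apply: eq_bigr => i _.
    by rewrite -[lshift _ _]/(fintype.unsplit (inl i)) fintype.unsplitK.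
  by rewrite -[rshift _ _]/(fintype.unsplit (inr i)) fintype.unsplitK.
Qed.

Lemma approx_cst D f e c : lmeasurable D ->
  (forall s, D s -> mdist c (f s) <= e) ->
  approx_integral D f e (lmeas D *s P c).
Proof.
move=> mD cf; exists (fun=> c) => //; exists 1%N, (fun=> D), (fun=> c); split => //.
- by apply/trivIsetP => i j _ _; rewrite !ord1 eqxx.
- by apply/seteqP; split => [s []|s Ds] //; exists ord0.
- by rewrite big_ord1.
Qed.

End approx.

Arguments approx_integral {R X} P D f e v.

(** * Existence and stability of the integral *)

Section Xintegral.
Context {R : realType} {X : lspaceType R} {P : X -> X}.
Hypothesis Pc : convexifying P.
Implicit Types (D : set R) (f g : R -> X) (v w : X) (e : R).

Lemma is_integral_approx D f v e : is_integral P D f v -> 0 < e ->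
  exists2 w, approx_integral P D f e w & mdist v w <= e.
Proof.
move=> [g [w [gw gf wv]]] e0.
have [k [gk wk]] : exists k, (forall s, D s -> mdist (f s) (g k s) < e) /\
    mdist v (w k) < e.
  have /filter_ex : \forall k \near \oo, (forall s, D s -> mdist (f s) (g k s) < e) /\
      mdist v (w k) < e.
    apply: filterI; last exact: (metricType_numDomainType.cvgr_dist_lt wv).
    apply: (gf [set h | forall s, D s -> mdist (f s) (h s) < e]).
    apply/uniform_nbhs; exists [set xy | ball xy.1 e xy.2]; split.
      by rewrite -entourage_ballE; exists e.
    by move=> h /= fh s /fh; rewrite ballEmdist.
  by [].
exists (w k); last exact: ltW.
by exists (g k) => // s Ds; rewrite metric_sym ltW// gk.
Qed.

Lemma is_integral_dist D f v w e : (completed_lebesgue_measure D < +oo)%E ->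
  is_integral P D f v -> approx_integral P D f e w ->
  mdist v w <= e * lmeas D.
Proof.
move=> Doo fv fw; apply/ler_addgt0Pl => /= d d0.
have D0 : 0 <= lmeas D by exact: lmeas_ge0.
(* This tolerance is paid once between [v] and [u] and [lmeas D] times between the simple values,
   hence the denominator. *)
have d'0 : 0 < d / (1 + lmeas D) by rewrite divr_gt0// ltr_pwDl.
have [u fu vu] := is_integral_approx fv d'0.
apply: le_trans (metric_triangle _ u _) _.
apply: le_trans (lerD vu (approx_dist Pc Doo fu fw)) _.
rewrite mulrDl addrA lerD2r le_eqVlt; apply/orP; left; apply/eqP.
by field; rewrite gt_eqF// ltr_pwDl.
Qed.

(** The values for tolerances [1 / (k + 1)] form a Cauchy sequence by [approx_dist], and [X] is
    complete. *)
Lemma is_integral_exists D f : (completed_lebesgue_measure D < +oo)%E ->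
  (forall e, 0 < e -> exists v, approx_integral P D f e v) ->
  exists v, is_integral P D f v.
Proof.
move=> Doo fex.
have /choice[w fw] : forall k : nat, exists v,
    approx_integral P D f k.+1%:R^-1 v.
  by move=> k; apply: fex; rewrite invr_gt0.
have /choice[g gP] : forall k : nat, exists g : R -> X,
    simple_integral P D g (w k) /\
    forall s, D s -> mdist (g s) (f s) <= k.+1%:R^-1.
  by move=> k; have [g] := fw k; exists g.
have wc : cvg (w @ \oo).
  apply/cauchy_cvgP/cauchy_exP => e e0; have D0 : 0 <= lmeas D by exact: lmeas_ge0.
  have d0 : 0 < e / 2 / (1 + lmeas D) by rewrite !divr_gt0// ltr_pwDl.
  near \oo => k; exists (w k); rewrite ballEmdist.
  suff : \forall l \near \oo, mdist (w k) (w l) < e by [].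
  near=> l.
  apply: le_lt_trans (approx_dist Pc Doo (fw k) (fw l)) _.
  have kd : k.+1%:R^-1 < e / 2 / (1 + lmeas D).
    by near: k; exact: near_infty_natSinv_lt (PosNum d0).
  have ld : l.+1%:R^-1 < e / 2 / (1 + lmeas D).
    by near: l; exact: near_infty_natSinv_lt (PosNum d0).
  have -> : e = (e / 2 / (1 + lmeas D) + e / 2 / (1 + lmeas D)) * (1 + lmeas D).
    by field; rewrite gt_eqF// ltr_pwDl.
  apply: (@le_lt_trans _ _ ((k.+1%:R^-1 + l.+1%:R^-1) * (1 + lmeas D))).
    by rewrite ler_wpM2l ?addr_ge0 ?lerDr.
  by rewrite ltr_pM2r ?ltrD// ltr_pwDl.
exists (lim (w @ \oo)), g, w; split => //; first by move=> k; have [] := gP k.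
move=> Q /uniform_nbhs[E [+ EQ]]; rewrite -entourage_ballE => -[d /= d0 dE].
near=> k; apply: EQ => s Ds; apply: dE => /=; rewrite ballEmdist/= metric_sym.
apply: le_lt_trans ((gP k).2 _ Ds) _.
by near: k; exact: near_infty_natSinv_lt (PosNum d0).
Unshelve. all: by end_near. Qed.

(** Existence excludes the default value of [xget], and the bound holds for whichever integral it
    selects. *)
Lemma Xintegral_dist D f e v : (completed_lebesgue_measure D < +oo)%E ->
  (forall e, 0 < e -> exists v, approx_integral P D f e v) ->
  approx_integral P D f e v ->
  mdist (Xintegral P D f) v <= e * lmeas D.
Proof.
move=> Doo fex; apply: is_integral_dist => //.
by have [w fw] := is_integral_exists Doo fex; apply: xgetPex; exists w.
Qed.

End Xintegral.

(** A property that adds up over adjacent intervals need only be checked on short ones. This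
    induction serves in place of explicit partitions and Riemann sums. *)
Lemma interval_ind (R : realType) (Q : R -> R -> Prop) (c d eta : R) :
  0 < eta -> c <= d ->
  (forall x y z, c <= x -> x <= y -> y <= z -> z <= d ->
    Q x y -> Q y z -> Q x z) ->
  (forall x y, c <= x -> x <= y -> y <= d -> y - x <= eta -> Q x y) ->
  Q c d.
Proof.
move=> eta0 cd Qtrans Qsmall.
(* The successor makes [N] positive even when [c = d], and the step at most [eta]. *)
pose N := (Num.truncn ((d - c) / eta)).+1; pose st := (d - c) / N%:R.
have N0 : (0 : R) < N%:R by [].
have st0 : 0 <= st by rewrite divr_ge0// subr_ge0.
have st_eta : st <= eta.
  rewrite ler_pdivrMr// mulrC -ler_pdivrMr//.
  by rewrite ltW// Num.Theory.truncnS_gt.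
suff H i : (i <= N)%N -> Q c (c + i%:R * st).
  by have := H N (leqnn N); rewrite mulrC divfK ?gt_eqF// addrC subrK.
elim: i => [_|i IH iN].
  by rewrite mul0r addr0; apply: Qsmall; rewrite // subrr ltW.
have iNst : i.+1%:R * st <= d - c.
  rewrite -[leRHS](@divfK _ N%:R) ?gt_eqF// [leRHS]mulrC ler_wpM2r//.
  by rewrite ler_nat.
rewrite mulrSr mulrDl mul1r in iNst *.
have ist : 0 <= i%:R * st by rewrite mulr_ge0.
apply: (Qtrans _ (c + i%:R * st)); [lra..|exact/IH/ltnW|].
by apply: Qsmall; lra.
Qed.

(** * Integrals over intervals *)

Section itv.
Context {R : realType} {X : lspaceType R} {P : X -> X}.
Hypothesis Pc : convexifying P.
Implicit Types (f g : R -> X) (v w : X) (x y z e : R).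

Definition uniformly_continuous_on (c d : R) f := forall e, 0 < e ->
  exists2 eta, 0 < eta & forall s t, c <= s <= d -> c <= t <= d ->
    `|s - t| <= eta -> mdist (f s) (f t) <= e.

(** Intervals open on the left are disjoint when adjacent, so their values add. *)
Lemma approx_itvU x y z f e v w : x <= y -> y <= z ->
  approx_integral P `]x, y] f e v ->
  approx_integral P `]y, z] f e w ->
  approx_integral P `]x, z] f e (v +s w).
Proof.
move=> xy yz fv fw.
have -> : `]x, z]%classic = `]x, y] `|` `]y, z].
  by rewrite -itv_bndbnd_setU// bnd_simp.
apply: approx_setU fv fw; apply/seteqP; split => // s [] /=.
by rewrite !in_itv/= => /andP[_ sy] /andP[]; rewrite ltNge sy.
Qed.

Lemma approx_itv_cst x y f e c : x <= y ->
  (forall s, x < s -> s <= y -> mdist c (f s) <= e) ->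
  approx_integral P `]x, y] f e ((y - x) *s P c).
Proof.
move=> xy cf; rewrite -(lmeas_itvoc xy); apply: approx_cst.
  exact: lmeasurable_itv.
by move=> s /=; rewrite in_itv/= => /andP[xs sy]; exact: cf.
Qed.

(** The point [x] is a piece of measure 0: it adds [0 *s P (f x)], which leaves the value
    unchanged. *)
Lemma approx_itvcc x y f e v : x <= y -> 0 <= e ->
  approx_integral P `]x, y] f e v ->
  approx_integral P `[x, y] f e v.
Proof.
move=> xy e0 fv; rewrite -(sadd0s v) -(sscale0 (P (f x))) -(lmeas_set1 x).
rewrite -set_itv1.
have -> : `[x, y]%classic = `[x, x] `|` `]x, y].
  by rewrite -itv_bndbnd_setU// bnd_simp.
apply: approx_setU fv.
  apply/seteqP; split => // s [] /=.
  by rewrite !in_itv/= => /andP[_ sy] /andP[]; rewrite ltNge sy.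
apply: approx_cst; first exact: lmeasurable_itv.
move=> s /=; rewrite in_itv/= => /andP[xs sx].
by have -> : s = x; [apply/eqP; rewrite eq_le xs sx|rewrite mdistxx].
Qed.

Lemma approx_exists c d f e : c <= d -> uniformly_continuous_on c d f ->
  0 < e -> exists v, approx_integral P `]c, d] f e v.
Proof.
move=> cd fc e0; have [eta eta0 fe] := fc e e0.
apply: (interval_ind (Q := fun x y => exists v,
  approx_integral P `]x, y] f e v) eta0 cd).
  move=> x y z _ xy yz _ [v fv] [w fw]; exists (v +s w).
  exact: approx_itvU fv fw.
move=> x y cx xy yd yx; exists ((y - x) *s P (f y)); apply: approx_itv_cst => //.
move=> s xs sy; apply: fe; [lra..|].
by rewrite ger0_norm; lra.
Qed.

(** All later estimates reach [Xintegral] through this bound. *)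
Lemma Xintegral_itv_dist c d f e v : c <= d -> uniformly_continuous_on c d f ->
  0 <= e -> approx_integral P `]c, d] f e v ->
  mdist (Xintegral P `[c, d] f) v <= e * (d - c).
Proof.
move=> cd fc e0 fv.
have cdE : completed_lebesgue_measure `[c, d] = (d - c)%:E.
  rewrite -[LHS]/(lebesgue_measure `[c, d]%classic).
  rewrite lebesgue_measure_itv/= lte_fin.
  by move: cd; rewrite le_eqVlt => /predU1P[->|->]; rewrite ?ltxx ?subrr// -EFinB.
rewrite -[d - c]/(fine (d - c)%:E) -cdE; apply: Xintegral_dist => //.
- by rewrite cdE ltry.
- move=> e' e'0; have [w fw] := approx_exists cd fc e'0.
  by exists w; apply: approx_itvcc => //; exact: ltW.
- exact: approx_itvcc.
Qed.

End itv.

(** * The error of the midpoint method *)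

Section modulus.
Context {R : realType} {omega : R -> R}.
Hypothesis om : modulus_of_continuity omega.
Notation mu := (@lebesgue_measure R).

Lemma modulus_small e : 0 < e -> exists2 eta, 0 < eta & omega eta <= e.
Proof.
move=> e0; have /continuous_within_itvcyP[_ om0] := modulus_continuous om.
have : \forall x \near 0^'+, 0 < x /\ omega x <= e.
  near=> x; split; first by near: x; exact: nbhs_right_gt.
  have : `|omega 0 - omega x| <= e by near: x; exact: cvgr_dist_le.
  by rewrite modulus0// sub0r normrN; apply: le_trans; exact: ler_norm.
by move=> /filter_ex[x [x0 xe]]; exists x.
Unshelve. all: by end_near. Qed.

Lemma modulus_integrable y : mu.-integrable `[0, y] (EFin \o omega).
Proof.
apply: continuous_compact_integrable; first exact: segment_compact.
apply: continuous_subspaceW (modulus_continuous om).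
by move=> x /=; rewrite !in_itv/= => /andP[->].
Qed.

(** By monotonicity the left-endpoint rectangle lies below the graph. Such rectangles are the cost
    of each small step of the transport in [half_cell_dist]. *)
Lemma modulus_integral_ge x y : 0 <= x -> x <= y ->
  (y - x) * omega x <=
  \int[mu]_(t in `[0, y]) omega t - \int[mu]_(t in `[0, x]) omega t.
Proof.
move=> x0 xy; have omy := modulus_integrable y.
rewrite Rintegral_itvB ?bnd_simp//.
have -> : (y - x) * omega x = \int[mu]_(t in `]x, y]) (omega x).
  rewrite Rintegral_cst//= mulrC -[in LHS](lmeas_itvoc xy).
  by congr (_ * fine _).
have sxy : `]x, y] `<=` `[0, y].
  by move=> t /=; rewrite !in_itv/= => /andP[/ltW/(le_trans x0)-> ->].
apply: le_Rintegral => //.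
- apply: (@integrableS _ _ _ mu `[x, y]) => //; first exact: subset_itv_oc_cc.
  apply: continuous_compact_integrable; first exact: segment_compact.
  by apply: continuous_subspaceT => ?; exact: cst_continuous.
- exact: integrableS omy.
- move=> t /=; rewrite in_itv/= => /andP[/ltW xt _].
  exact: modulus_nondecreasing.
Qed.

End modulus.

Section upper_bound.
Context {R : realType} {X : lspaceType R} {P : X -> X} {omega : R -> R}.
Hypotheses (Pc : convexifying P) (om : modulus_of_continuity omega).
Notation mu := (@lebesgue_measure R).
Implicit Types (f : R -> X) (v w : X) (a b c d t x y z e : R) (o : bool).

Lemma Hclass_uniformly_continuous a b c d f : a <= c -> d <= b ->
  Hclass omega a b f -> uniformly_continuous_on c d f.
Proof.
move=> ac db Hf e e0; have [eta eta0 ome] := modulus_small om e0.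
exists eta => // s t /andP[cs sd] /andP[ct td] st.
apply: le_trans (Hf _ _ _ _) _; rewrite ?in_itv/=; [lra|lra|].
by apply: le_trans ome; exact: modulus_nondecreasing.
Qed.

(* o selects one of the two sides of t, whose points are parameterized by their
   distance to t, so that both halves of a cell are treated at once. *)
Definition at_dist o t x : R := if o then t + x else t - x.

(** Both variants are open on the left in the real line, as [approx_itvU] requires; the open end is
    thus the one near [t] on the right side and the far one on the left side. *)
Definition seg o t x y : set R :=
  if o then `]t + x, t + y]%classic else `]t - y, t - x]%classic.

Lemma approx_segU o t x y z f e v w : x <= y -> y <= z ->
  approx_integral P (seg o t x y) f e v ->
  approx_integral P (seg o t y z) f e w ->
  approx_integral P (seg o t x z) f e (v +s w).
Proof.
move=> xy yz; case: o => /= fv fw.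
  by apply: approx_itvU fv fw; rewrite lerD2l.
by rewrite saddC; apply: approx_itvU fw fv; rewrite lerD2l lerN2.
Qed.

Lemma approx_seg_cst o t x y f e (c : X) : x <= y ->
  (forall s, x <= s -> s <= y -> mdist c (f (at_dist o t s)) <= e) ->
  approx_integral P (seg o t x y) f e ((y - x) *s P c).
Proof.
move=> xy cf; case: o cf => /= cf.
  have -> : y - x = (t + y) - (t + x) by lra.
  apply: approx_itv_cst => [|s xs sy]; first lra.
  by have := cf (s - t); rewrite (addrC t) subrK; apply; lra.
have -> : y - x = (t - x) - (t - y) by lra.
apply: approx_itv_cst => [|s xs sy]; first lra.
by have := cf (t - s); rewrite subKr; apply; lra.
Qed.

(* The point at distance h + (1 - p) x of t is transported to the point at
   distance h - p x, where p = h / d, which moves it by x: the outer mass on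
   [h, d] goes to the inner mass on [0, h]. *)
Lemma half_cell_dist o t d h e f : 0 < h -> h <= d -> 0 < e ->
  Hclass omega (t - d) (t + d) f ->
  let p := h / d in
  exists v w, [/\ approx_integral P (seg o t h d) f e v,
    approx_integral P (seg o t 0 h) f e w &
    mdist v (((1 - p) / p) *s w) <=
      (1 - p) * \int[mu]_(t in `[0, d]) omega t].
Proof.
move=> h0 hd e0 Hf p.
have d0 : 0 < d by exact: lt_le_trans hd.
have p0 : 0 < p by rewrite divr_gt0.
have pd : p * d = h by rewrite divfK ?gt_eqF.
have p1 : 0 <= 1 - p by rewrite subr_ge0 ler_pdivrMr ?mul1r.
have [eta eta0 ome] := modulus_small om e0.
pose F y := \int[mu]_(t in `[0, y]) omega t.
have F0 : F 0 = 0 by rewrite /F set_itv1 Rintegral_set1.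
have Hf' r s : 0 <= r <= d -> 0 <= s <= d ->
    mdist (f (at_dist o t r)) (f (at_dist o t s)) <= omega `|r - s|.
  move=> rd sd; have -> : `|r - s| = `|at_dist o t r - at_dist o t s|.
    by rewrite /at_dist; case: o {Hf}; [|rewrite distrC]; congr `|_|; lra.
  by apply: Hf; rewrite /at_dist; case: o; rewrite in_itv/=; lra.
(* The parameter is the displacement. At 0 both segments start at distance [h] from [t]; at [d] the
   outer one has reached distance [d] and the inner one 0. *)
have : exists v w, [/\
    approx_integral P (seg o t (h + (1 - p) * 0) (h + (1 - p) * d)) f e v,
    approx_integral P (seg o t (h - p * d) (h - p * 0)) f e w &
    mdist v (((1 - p) / p) *s w) <= (1 - p) * (F d - F 0)].
  apply: (interval_ind (Q := fun x y => exists v w, [/\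
    approx_integral P (seg o t (h + (1 - p) * x) (h + (1 - p) * y)) f e v,
    approx_integral P (seg o t (h - p * y) (h - p * x)) f e w &
    mdist v (((1 - p) / p) *s w) <= (1 - p) * (F y - F x)]) eta0 (ltW d0)).
    move=> x y z x0 xy yz zd [v [w [fv fw vw]]] [v' [w' [fv' fw' vw']]].
    exists (v +s v'), (w' +s w); split.
    - by apply: approx_segU fv fv'; rewrite lerD2l ler_wpM2l.
    - by apply: approx_segU fw' fw; rewrite lerD2l lerN2 ler_wpM2l// ltW.
    - rewrite saddC sscaleDr; apply: le_trans (le_mdist_sadd2 _ _ _ _) _.
      apply: le_trans (lerD vw' vw) _.
      by rewrite -mulrDr ler_wpM2l//; lra.
  move=> x y x0 xy yd yx.
  have px : 0 <= p * x <= h.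
    by rewrite mulr_ge0 ?(ltW p0)// -pd ler_wpM2l ?(ltW p0) ?(le_trans xy).
  have py : 0 <= p * y <= h.
    by rewrite mulr_ge0 ?(ltW p0) ?(le_trans x0)// -pd ler_wpM2l ?(ltW p0).
  have pxy : p * x <= p * y <= p * x + eta.
    rewrite ler_wpM2l ?(ltW p0)//= -lerBlDl -mulrBr.
    by apply: le_trans yx; rewrite ler_piMl; lra.
  have qxy : 0 <= (1 - p) * x <= (1 - p) * y by rewrite mulr_ge0//= ler_wpM2l.
  have qyd : (1 - p) * y <= (1 - p) * d by rewrite ler_wpM2l.
  (* On a short step [f] is frozen, on each segment, at the point of parameter [x]. *)
  exists (((h + (1 - p) * y) - (h + (1 - p) * x)) *s
    P (f (at_dist o t (h + (1 - p) * x)))).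
  exists (((h - p * x) - (h - p * y)) *s P (f (at_dist o t (h - p * x)))).
  split.
  - apply: approx_seg_cst; first by rewrite lerD2l ler_wpM2l.
    move=> s xs sy; apply: le_trans (Hf' _ _ _ _) _; [lra|lra|].
    apply: le_trans ome; apply: modulus_nondecreasing => //.
    rewrite ler0_norm; lra.
  - apply: approx_seg_cst; first by lra.
    move=> s xs sy; apply: le_trans (Hf' _ _ _ _) _; [lra|lra|].
    apply: le_trans ome; apply: modulus_nondecreasing => //.
    rewrite ger0_norm; lra.
  rewrite sscaleA.
  (* Rescaling by [(1 - p) / p] makes the inner and outer masses equal. *)
  have -> : (1 - p) / p * (h - p * x - (h - p * y)) =
      h + (1 - p) * y - (h + (1 - p) * x) by field; rewrite gt_eqF.
  have yx0 : 0 <= h + (1 - p) * y - (h + (1 - p) * x).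
    have -> : h + (1 - p) * y - (h + (1 - p) * x) = (1 - p) * (y - x) by lra.
    by rewrite mulr_ge0// subr_ge0.
  rewrite mdist_sscale_ge0//.
  have -> : h + (1 - p) * y - (h + (1 - p) * x) = (1 - p) * (y - x) by lra.
  rewrite -mulrA ler_wpM2l//; apply: le_trans (modulus_integral_ge om x0 xy).
  rewrite ler_wpM2l ?subr_ge0//; apply: le_trans (convexifying_le Pc _ _) _.
  apply: le_trans (Hf' _ _ _ _) _; [lra|lra|].
  have -> : h + (1 - p) * x - (h - p * x) = x by lra.
  by rewrite ger0_norm.
have -> : h + (1 - p) * d = d by lra.
by rewrite !mulr0 addr0 subr0 pd subrr F0 subr0.
Qed.

(** With [p = h / d], [d / h = 1 + (1 - p) / p]: scaling the inner integral keeps it once and sets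
    the rest against the outer part. The term [2 * d * e] is [d / h] times the error [2 * h * e] on
    the inner integral. *)
Lemma cell_dist t d h e f : 0 < h -> h <= d -> 0 < e ->
  Hclass omega (t - d) (t + d) f ->
  exists2 v, approx_integral P `]t - d, t + d] f e v &
    mdist v ((d / h) *s Xintegral P `[t - h, t + h] f) <=
      2 * (1 - h / d) * \int[mu]_(t in `[0, d]) omega t + 2 * d * e.
Proof.
move=> h0 hd e0 Hf; have d0 : 0 < d by exact: lt_le_trans hd.
have dh0 : 0 <= d / h by rewrite divr_ge0// ltW.
have [v1 [w1 [fv1 fw1 vw1]]] := half_cell_dist true h0 hd e0 Hf.
have [v0 [w0 [fv0 fw0 vw0]]] := half_cell_dist false h0 hd e0 Hf.
have glue x u v : 0 <= x ->
  approx_integral P (seg false t 0 x) f e u ->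
  approx_integral P (seg true t 0 x) f e v ->
  approx_integral P `]t - x, t + x] f e (u +s v).
  move=> x0; rewrite /seg addr0 subr0; apply: approx_itvU; lra.
have fW := glue h _ _ (ltW h0) fw0 fw1.
have fV := glue d _ _ (ltW d0)
  (approx_segU (ltW h0) hd fw0 fv0) (approx_segU (ltW h0) hd fw1 fv1).
exists (w0 +s v0 +s (w1 +s v1)) => //.
have uc : uniformly_continuous_on (t - h) (t + h) f.
  by apply: Hclass_uniformly_continuous Hf; lra.
have thh : t - h <= t + h by lra.
have WI := Xintegral_itv_dist Pc thh uc (ltW e0) fW.
(* Splitting the scalar [d / h] requires [w] convex, as values of approximate integrals are. *)
have split_w v w : convex_elt w ->
    mdist v (((1 - h / d) / (h / d)) *s w) <=
      (1 - h / d) * \int[mu]_(t in `[0, d]) omega t ->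
    mdist (w +s v) ((d / h) *s w) <=
      (1 - h / d) * \int[mu]_(t in `[0, d]) omega t.
  move=> cw; apply: le_trans.
  have -> : d / h = 1 + (1 - h / d) / (h / d) by field; rewrite !gt_eqF.
  rewrite cw ?sscale1; last 2 first.
  - by [].
  - by rewrite !divr_ge0 ?subr_ge0 ?ler_pdivrMr ?mul1r// ltW.
  by apply: le_trans (le_mdist_sadd2 _ _ _ _) _; rewrite mdistxx add0r.
have D0 := split_w _ _ (approx_convex Pc fw0) vw0.
have D1 := split_w _ _ (approx_convex Pc fw1) vw1.
apply: le_trans (metric_triangle _ ((d / h) *s (w0 +s w1)) _) _.
apply: lerD.
  rewrite sscaleDr; apply: le_trans (le_mdist_sadd2 _ _ _ _) _.
  by apply: le_trans (lerD D0 D1) _; lra.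
rewrite mdist_sscale_ge0// metric_sym.
apply: le_trans (ler_wpM2l dh0 WI) _.
rewrite le_eqVlt; apply/orP; left; apply/eqP; field; rewrite gt_eqF//.
Qed.

Lemma sum_cells_dist a d h e f n : 0 < h -> h <= d -> 0 < e ->
  Hclass omega a (a + 2 * d * n%:R) f ->
  exists2 v, approx_integral P `]a, a + 2 * d * n%:R] f e v &
    mdist v (\ssum_(k < n) ((d / h) *s Xintegral P
      `[a + 2 * d * k%:R + d - h, a + 2 * d * k%:R + d + h] f)) <=
      n%:R * (2 * (1 - h / d) * \int[mu]_(t in `[0, d]) omega t + 2 * d * e).
Proof.
move=> h0 hd e0; have d0 : 0 < d by exact: lt_le_trans hd.
have d2 m : 2 * d * m.+1%:R = 2 * d * m%:R + 2 * d by rewrite (mulrSr 1 m) mulrDr mulr1.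
elim: n => [|n IH] Hf.
  exists stheta; last by rewrite big_ord0 mdistxx mul0r.
  have := @approx_itv_cst _ _ P a a f e (f a) (lexx _).
  rewrite mulr0 addr0 subrr sscale0; apply => s.
  by move=> /lt_le_trans/[apply]; rewrite ltxx.
have n0 : 0 <= 2 * d * n%:R by rewrite mulr_ge0// mulr_ge0// ltW.
have [v fv vD] : exists2 v, approx_integral P `]a, a + 2 * d * n%:R] f e v &
    mdist v (\ssum_(k < n) ((d / h) *s Xintegral P
      `[a + 2 * d * k%:R + d - h, a + 2 * d * k%:R + d + h] f)) <=
      n%:R * (2 * (1 - h / d) * \int[mu]_(t in `[0, d]) omega t + 2 * d * e).
  by apply: IH => s t; rewrite !in_itv/= => sa ta; apply: Hf; rewrite in_itv/= d2; lra.
have [w] : exists2 w, approx_integral P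
    `]a + 2 * d * n%:R + d - d, a + 2 * d * n%:R + d + d] f e w &
    mdist w ((d / h) *s Xintegral P
      `[a + 2 * d * n%:R + d - h, a + 2 * d * n%:R + d + h] f) <=
      2 * (1 - h / d) * \int[mu]_(t in `[0, d]) omega t + 2 * d * e.
  apply: cell_dist => // s t; rewrite !in_itv/= => sa ta.
  by apply: Hf; rewrite in_itv/= d2; lra.
have -> : a + 2 * d * n%:R + d - d = a + 2 * d * n%:R by lra.
have -> : a + 2 * d * n%:R + d + d = a + 2 * d * n.+1%:R by rewrite d2; lra.
move=> fw wD; exists (v +s w).
  by apply: approx_itvU fv fw; rewrite ?d2; lra.
rewrite big_ord_recr/=; apply: le_trans (le_mdist_sadd2 _ _ _ _) _.
by apply: le_trans (lerD vD wD) _; rewrite (mulrSr 1 n) [leRHS]mulrDl mul1r.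
Qed.

Lemma midpoints_error a b h n f : (0 < n)%N -> 0 < h ->
  2 * n%:R * h <= b - a -> Hclass omega a b f ->
  mdist (Xintegral P `[a, b] f)
    (mean_method a b n (mean_info P h n (midpoints a b n) f)) <=
  2 * n%:R * (1 - 2 * n%:R * h / (b - a)) *
    \int[mu]_(t in `[0, (b - a) / (2 * n%:R)]) omega t.
Proof.
move=> n0 h0 nh Hf; set d := (b - a) / (2 * n%:R).
have nR0 : (0 : R) < n%:R by rewrite ltr0n.
have hd : h <= d by rewrite ler_pdivlMr ?mulr_gt0// mulrC.
have d0 : 0 < d by exact: lt_le_trans hd.
have ab : a < b by rewrite -subr_gt0; apply: lt_le_trans nh; rewrite !mulr_gt0.
have bE : b = a + 2 * d * n%:R by rewrite /d; field; rewrite gt_eqF.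
have MM : mean_method a b n (mean_info P h n (midpoints a b n) f) =
    \ssum_(k < n) ((d / h) *s Xintegral P
      `[a + 2 * d * k%:R + d - h, a + 2 * d * k%:R + d + h] f).
  rewrite /mean_method sscale_sumr; apply: eq_bigr => k _.
  rewrite /mean_info sscaleA /midpoints.
  have -> : a + (2 * k.+1%:R - 1) * (b - a) / (2 * n%:R) = a + 2 * d * k%:R + d.
    by rewrite (mulrSr 1 k) /d; field; rewrite gt_eqF.
  by congr (_ *s _); rewrite /d; field; rewrite !gt_eqF.
rewrite MM; apply/ler_addgt0Pl => /= e e0.
(* With this tolerance the integral over [[a, b]] and the sum over the cells lose [e / 2] each. *)
have e'0 : 0 < e / (2 * (b - a)) by rewrite divr_gt0// mulr_gt0// subr_gt0.
have [v fv vD] : exists2 v, approx_integral P `]a, b] f (e / (2 * (b - a))) v &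
    mdist v (\ssum_(k < n) ((d / h) *s Xintegral P
      `[a + 2 * d * k%:R + d - h, a + 2 * d * k%:R + d + h] f)) <=
      n%:R * (2 * (1 - h / d) * \int[mu]_(t in `[0, d]) omega t
        + 2 * d * (e / (2 * (b - a)))).
  by rewrite bE; apply: sum_cells_dist => //; rewrite -bE.
have uc : uniformly_continuous_on a b f.
  exact: Hclass_uniformly_continuous (lexx _) (lexx _) Hf.
apply: le_trans (metric_triangle _ v _) _.
apply: le_trans (lerD (Xintegral_itv_dist Pc (ltW ab) uc (ltW e'0) fv) vD) _.
rewrite le_eqVlt; apply/orP; left; apply/eqP.
have -> : 2 * n%:R * h / (b - a) = h / d.
  by rewrite /d; field; rewrite !gt_eqF// subr_gt0.
have -> : n%:R * (2 * (1 - h / d) * \int[mu]_(t in `[0, d]) omega t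
  + 2 * d * (e / (2 * (b - a)))) =
  2 * n%:R * (1 - h / d) * \int[mu]_(t in `[0, d]) omega t + e / 2.
  rewrite mulrDr; congr (_ + _); first ring.
  by rewrite /d; field; rewrite !gt_eqF// subr_gt0.
have -> : e / (2 * (b - a)) * (b - a) = e / 2.
  by field; rewrite gt_eqF// subr_gt0.
by rewrite addrCA -splitr addrC.
Qed.

End upper_bound.

(** * The extremal scalar function *)

Section Rintegral_continuous.
Context {R : realType}.
Notation mu := (@lebesgue_measure R).
Implicit Types (g G : R -> R) (a b c d x y : R).

Lemma continuous_integrable g x y : continuous g ->
  mu.-integrable `[x, y] (EFin \o g).
Proof.
move=> cg; apply: continuous_compact_integrable; first exact: segment_compact.
exact: continuous_subspaceT.
Qed.

Lemma Rintegral_itv_split g x y z : continuous g -> x <= y -> y <= z ->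
  \int[mu]_(t in `[x, z]) g t =
  \int[mu]_(t in `[x, y]) g t + \int[mu]_(t in `[y, z]) g t.
Proof.
move=> cg xy yz; apply/eqP; rewrite addrC -subr_eq; apply/eqP.
rewrite Rintegral_itvB ?bnd_simp//; last exact: continuous_integrable.
rewrite Rintegral_itv_obnd_cbnd//.
by apply: integrableS (continuous_integrable y z cg) => //; exact: subset_itv_oc_cc.
Qed.

Lemma Rintegral_itv_cst x y c : x <= y -> \int[mu]_(t in `[x, y]) c = c * (y - x).
Proof.
move=> xy; rewrite Rintegral_cst//= lebesgue_measure_itv/= lte_fin.
by move: xy; rewrite le_eqVlt => /predU1P[->|->]; rewrite ?ltxx ?subrr.
Qed.

Lemma le_Rintegral_itv g G x y : continuous g -> continuous G ->
  (forall t, x <= t <= y -> g t <= G t) ->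
  \int[mu]_(t in `[x, y]) g t <= \int[mu]_(t in `[x, y]) G t.
Proof.
move=> cg cG gG; apply: le_Rintegral => //; exact: continuous_integrable.
Qed.

Lemma eq_Rintegral_itv g G x y : (forall t, x <= t <= y -> g t = G t) ->
  \int[mu]_(t in `[x, y]) g t = \int[mu]_(t in `[x, y]) G t.
Proof.
by move=> gG; apply: eq_Rintegral => t; rewrite inE/= in_itv/= => /gG.
Qed.

Lemma Rintegral_itv_sum n (g : 'I_n -> R -> R) x y :
  (forall k, continuous (g k)) ->
  \int[mu]_(t in `[x, y]) (\sum_(k < n) g k t) =
  \sum_(k < n) \int[mu]_(t in `[x, y]) g k t.
Proof.
move=> cg; rewrite /Rintegral; under eq_integral do rewrite -sumEFin.
rewrite integral_sum//=; last by move=> k; exact: continuous_integrable.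
rewrite sum_fine// => k _; apply: integrable_fin_num => //.
exact: continuous_integrable.
Qed.

(** The intervals may lie anywhere and are compared through their hull: extending [[c, d]] to it
    adds only zeros, restricting it to [[a, b]] discards nonpositive mass. *)
Lemma Rintegral_le0_widen g a b c d : continuous g -> a <= b -> c <= d ->
  (forall t, g t <= 0) -> (forall t, t <= c -> g t = 0) ->
  (forall t, d <= t -> g t = 0) ->
  \int[mu]_(t in `[c, d]) g t <= \int[mu]_(t in `[a, b]) g t.
Proof.
move=> cg ab cd g0 gc gd.
have le0 x y : x <= y -> \int[mu]_(t in `[x, y]) g t <= 0.
  move=> xy; have <- : \int[mu]_(t in `[x, y]) (0 : R) = 0.
    by rewrite Rintegral_itv_cst// mul0r.
  by apply: le_Rintegral_itv => // ?; exact: cst_continuous.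
have eq0 x y : x <= y -> (forall t, x <= t <= y -> g t = 0) ->
    \int[mu]_(t in `[x, y]) g t = 0.
  by move=> xy /eq_Rintegral_itv ->; rewrite Rintegral_itv_cst// mul0r.
have [la lc] : Num.min a c <= a /\ Num.min a c <= c by rewrite !ge_min !lexx orbT.
have [hb hd] : b <= Num.max b d /\ d <= Num.max b d by rewrite !le_max !lexx orbT.
have := Rintegral_itv_split cg la (le_trans ab hb).
rewrite (Rintegral_itv_split cg ab hb).
rewrite (Rintegral_itv_split cg lc (le_trans cd hd)).
rewrite (Rintegral_itv_split cg cd hd).
rewrite (eq0 _ _ lc) => [|t /andP[_ tc]]; last exact: gc.
rewrite (eq0 _ _ hd) => [|t /andP[dt _]]; last exact: gd.
by rewrite add0r addr0 => ->; rewrite addrCA gerDl -[leRHS]addr0 lerD ?le0.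
Qed.

(** The scaled distance to the endpoint [x] becomes the variable. The two orientations, here and in
    [Rintegral_affine_decr], serve the pieces of a cell on either side of the points at distance [h]
    from its centre. *)
Lemma Rintegral_affine_incr G c x y : continuous G -> 0 < c -> 0 <= y ->
  \int[mu]_(t in `[x, x + y / c]) G (c * (t - x)) =
  c^-1 * \int[mu]_(t in `[0, y]) G t.
Proof.
move=> cG c0 y0; set F := fun t => c * (t - x).
have dF (t : R) : is_derive t 1 F c.
  rewrite /F; apply: is_derive_eq; rewrite subr0; exact: mulr1.
have F' : derive1 F = cst c.
  by apply/funext => t; rewrite derive1E derive_val.
have cF : continuous F.
  by move=> t; apply/differentiable_continuous/derivable1_diffP.
have Fx : F x = 0 by rewrite /F subrr mulr0.
have Fy : F (x + y / c) = y by rewrite /F; field; rewrite gt_eqF.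
have xy : x <= x + y / c by rewrite lerDl divr_ge0// ltW.
have : \int[mu]_(t in `[0, y]) G t =
    \int[mu]_(t in `[x, x + y / c]) (G (F t) * c).
  rewrite -{1}Fx -{1}Fy; congr fine.
  rewrite integration_by_substitution_increasing//.
  - by apply: eq_integral => t _; rewrite F'.
  - by move=> s t _ _ st; rewrite /F ltr_pM2l// ltrD2r.
  - by rewrite F' => t _; exact: cst_continuous.
  - by rewrite F'; exact: is_cvg_cst.
  - by rewrite F'; exact: is_cvg_cst.
  - split; [by move=> t _|exact/cvg_at_right_filter/cF|exact/cvg_at_left_filter/cF].
  - exact: continuous_subspaceT.
rewrite RintegralZr//; last first.
  apply: continuous_integrable => t; exact: continuous_comp (cF t) (cG _).
by move=> ->; rewrite mulrCA mulVf ?mulr1 ?gt_eqF.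
Qed.

Lemma Rintegral_affine_decr G c x y : continuous G -> 0 < c -> 0 <= y ->
  \int[mu]_(t in `[x - y / c, x]) G (c * (x - t)) =
  c^-1 * \int[mu]_(t in `[0, y]) G t.
Proof.
move=> cG c0 y0; set F := fun t => c * (x - t).
have dF (t : R) : is_derive t 1 F (- c).
  rewrite /F; apply: is_derive_eq; rewrite add0r mul1r; exact: mulrN1.
have F' : derive1 F = cst (- c).
  by apply/funext => t; rewrite derive1E derive_val.
have cF : continuous F.
  by move=> t; apply/differentiable_continuous/derivable1_diffP.
have Fx : F x = 0 by rewrite /F subrr mulr0.
have Fy : F (x - y / c) = y by rewrite /F; field; rewrite gt_eqF.
have xy : x - y / c <= x by rewrite gerBl divr_ge0// ltW.
have : \int[mu]_(t in `[0, y]) G t =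
    \int[mu]_(t in `[x - y / c, x]) (G (F t) * c).
  rewrite -{1}Fx -{1}Fy; congr fine.
  rewrite integration_by_substitution_decreasing//.
  - by apply: eq_integral => t _; rewrite F' /= opprK.
  - by move=> s t _ _ st; rewrite /F ltr_pM2l// ltrD2l ltrN2.
  - by rewrite F' => t _; exact: cst_continuous.
  - by rewrite F'; exact: is_cvg_cst.
  - by rewrite F'; exact: is_cvg_cst.
  - split; [by move=> t _|exact/cvg_at_right_filter/cF|exact/cvg_at_left_filter/cF].
  - exact: continuous_subspaceT.
rewrite RintegralZr//; last first.
  apply: continuous_integrable => t; exact: continuous_comp (cF t) (cG _).
by move=> ->; rewrite mulrCA mulVf ?mulr1 ?gt_eqF.
Qed.

End Rintegral_continuous.

(** * Concave moduli and the extremal profile *)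

Section modulus_scalar.
Context {R : realType} {omega : R -> R}.
Hypotheses (om : modulus_of_continuity omega)
  (omc : concave_on `[0, +oo[ omega).
Implicit Types (p s t x y : R) (g : R -> R).

Lemma modulus_concave l x y : 0 <= l <= 1 -> 0 <= x -> 0 <= y ->
  l * omega x + (1 - l) * omega y <= omega (l * x + (1 - l) * y).
Proof.
move=> /andP[l0 l1] x0 y0.
have := omc (Itv01 l0 l1); move=> /(_ x y); rewrite !inE/= !in_itv/= !andbT.
move=> /(_ x0 y0); rewrite !convRE/= -lerN2.
rewrite opprK mulrN mulrN opprD !opprK; exact.
Qed.

Lemma modulus_contract l x : 0 <= l <= 1 -> 0 <= x -> l * omega x <= omega (l * x).
Proof.
move=> l01 x0; have := modulus_concave l01 x0 (lexx 0).
by rewrite modulus0// !mulr0 !addr0.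
Qed.

Lemma modulus_sub x y : 0 <= y -> y <= x -> omega x - omega y <= omega (x - y).
Proof.
move=> y0 yx; rewrite lerBlDr.
have xy : 0 <= x - y by rewrite subr_ge0.
by have := modulus_semiadditive om xy y0; rewrite subrK.
Qed.

Definition has_modulus g := forall s t, `|g s - g t| <= omega `|s - t|.

Lemma has_modulusP g : (forall s t, t <= s -> `|g s - g t| <= omega (s - t)) ->
  has_modulus g.
Proof.
move=> gP s t; have [ts|/ltW st] := leP t s.
  by rewrite (ger0_norm (_ : 0 <= s - t)) ?subr_ge0// gP.
by rewrite distrC (distrC s) (ger0_norm (_ : 0 <= t - s)) ?subr_ge0// gP.
Qed.

Lemma has_modulus_continuous g : has_modulus g -> continuous g.
Proof.
move=> gom t; apply/cvgrPdist_le => /= e e0.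
have [eta eta0 ome] := modulus_small om e0.
near=> s; apply: le_trans (gom _ _) _; apply: le_trans ome.
apply: (modulus_nondecreasing om) => //.
Unshelve. all: by end_near. Qed.

(** The values of [omega] at negative arguments are arbitrary; composing with the norm gives a
    function continuous on the whole line. *)
Lemma has_modulus_normr : has_modulus (fun t => omega `|t|).
Proof.
move=> s t; wlog st : s t / `|t| <= `|s|.
  move=> H; have [|/ltW] := leP `|t| `|s|; first exact: H.
  by rewrite distrC (distrC s); exact: H.
rewrite ger0_norm ?subr_ge0 ?(modulus_nondecreasing om)//.
apply: le_trans (modulus_sub _ st) _ => //.
by apply: (modulus_nondecreasing om) => //; rewrite ?subr_ge0// lerB_dist.
Qed.

Lemma has_modulus_comp g u : (forall s t, `|u s - u t| <= `|s - t|) ->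
  has_modulus g -> has_modulus (g \o u).
Proof.
move=> u1 gom s t; apply: le_trans (gom _ _) _.
exact: (modulus_nondecreasing om).
Qed.

Lemma has_modulusDcst g c : has_modulus g -> has_modulus (fun t => g t + c).
Proof. by move=> gom s t; rewrite opprD addrACA subrr addr0. Qed.

Lemma has_modulus_min g c : has_modulus g ->
  has_modulus (fun t => Num.min (g t) c).
Proof.
move=> gom s t; apply: le_trans (gom s t).
have := ler_norm (g s - g t); have := ler_norm (- (g s - g t)); rewrite normrN.
move: `|g s - g t| => N h1 h2; rewrite ler_norml.
by case: (leP (g s) c); case: (leP (g t) c); lra.
Qed.

(* psi = extremal_profile p satisfies psi((1 - p) x) - psi(- p x) = omega x for
   x >= 0: with p = h / d, the function psi(s - h) of the distance s to the
   centre of a cell gives equality in half_cell_dist. *)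
Definition extremal_profile p s : R :=
  if 0 <= s then (1 - p) * omega (s / (1 - p)) else - (p * omega (- s / p)).

Lemma extremal_profile_nondecreasing p s t : 0 < p < 1 -> s <= t ->
  extremal_profile p s <= extremal_profile p t.
Proof.
move=> /andP[p0 p1] st; rewrite /extremal_profile.
have q0 : 0 < 1 - p by rewrite subr_gt0.
have [s0|s0] := leP 0 s.
  rewrite (le_trans s0 st) ler_wpM2l ?(ltW q0)//.
  apply: (modulus_nondecreasing om) => //; first by rewrite divr_ge0 ?(ltW q0).
  by rewrite ler_pM2r ?invr_gt0.
have [t0|t0] := leP 0 t.
  apply: (@le_trans _ _ 0).
    by rewrite oppr_le0 mulr_ge0 ?(ltW p0) ?(modulus_ge0 om)// divr_ge0// ?oppr_ge0 ltW.
  by rewrite mulr_ge0 ?(ltW q0) ?(modulus_ge0 om)// divr_ge0// ltW.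
rewrite lerN2 ler_wpM2l ?(ltW p0)//.
apply: (modulus_nondecreasing om) => //; first by rewrite divr_ge0// ?oppr_ge0 ltW.
by rewrite ler_pM2r ?invr_gt0// lerN2.
Qed.

(** For arguments of the same sign, semi-additivity bounds the difference by
    [l * omega ((x - y) / l)], and concavity with [omega 0 = 0] absorbs [l]. For opposite signs it
    is concavity with weights [1 - p] and [p]. *)
Lemma extremal_profile_modulus p : 0 < p < 1 -> has_modulus (extremal_profile p).
Proof.
move=> p01; apply: has_modulusP => s t ts.
rewrite ger0_norm ?subr_ge0 ?extremal_profile_nondecreasing//.
move: p01 => /andP[p0 p1]; have q0 : 0 < 1 - p by rewrite subr_gt0.
have same l x y : 0 < l -> l < 1 -> 0 <= y -> y <= x ->
    l * omega (x / l) - l * omega (y / l) <= omega (x - y).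
  move=> l0 l1 y0 yx; rewrite -mulrBr.
  have -> : x - y = l * (x / l - y / l) by field; rewrite gt_eqF.
  apply: le_trans (modulus_contract _ _).
  - rewrite ler_wpM2l ?(ltW l0)//; apply: modulus_sub.
      by rewrite divr_ge0 ?(ltW l0).
    by rewrite ler_pM2r ?invr_gt0.
  - by rewrite !ltW.
  - by rewrite subr_ge0 ler_pM2r ?invr_gt0.
rewrite /extremal_profile; have [t0|t0] := leP 0 t.
  by rewrite (le_trans t0 ts); apply: same => //; rewrite gtrBl.
have [s0|s0] := leP 0 s.
  rewrite opprK; have -> : s - t = (1 - p) * (s / (1 - p)) + (1 - (1 - p)) * (- t / p).
    by field; rewrite !gt_eqF.
  rewrite -[X in _ + X * _ <= _](subKr 1); apply: modulus_concave.
  - by rewrite subr_ge0 gerBl !ltW.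
  - by rewrite divr_ge0 ?(ltW q0).
  - by rewrite divr_ge0// ?oppr_ge0 ltW.
rewrite opprK addrC; have -> : s - t = - t - - s by rewrite opprK addrC.
by apply: same; rewrite // ?lerN2 // oppr_ge0 ltW.
Qed.

End modulus_scalar.

Arguments has_modulus {R} omega g.
Arguments extremal_profile {R} omega p s.

(** * Geometry of admissible nodes *)

Section admissible.
Context {R : realType} {a b h : R} {n : nat}.
Implicit Types t : 'I_n -> R.
Hypothesis h0 : 0 < h.

Lemma admissible_lt t (i j : 'I_n) : admissible a b h n t -> (i < j)%N ->
  t i + 2 * h * (j - i)%:R < t j.
Proof.
move=> [_ tS _] ij.
have H k (kn : (k < n)%N) : (i < k)%N -> t i + 2 * h * (k - i)%:R < t (Ordinal kn).
  elim: k kn => // k IH kn; rewrite ltnS leq_eqVlt => /predU1P[ik|ik].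
    rewrite ik subSnn mulr1; have := tS i (Ordinal kn); rewrite /= ik.
    by move=> /(_ erefl); lra.
  have := IH (ltnW kn) ik; rewrite subSn ?(ltnW ik)// (mulrSr 1).
  by have := tS (Ordinal (ltnW kn)) (Ordinal kn) erefl; lra.
by have := H j (ltn_ord j) ij; congr (_ < t _); exact: val_inj.
Qed.

Lemma admissible_sep t (i j : 'I_n) : admissible a b h n t -> i != j ->
  2 * h <= `|t i - t j|.
Proof.
move=> adm; wlog ij : i j / (i < j)%N.
  move=> H ij; have : (i < j)%N || (j < i)%N by rewrite -neq_ltn.
  by move=> /orP[/H|/H]; [exact|rewrite distrC eq_sym; exact].
move=> _; have := admissible_lt adm ij.
have : (1 : R) <= (j - i)%:R by rewrite ler1n subn_gt0.
move=> /(ler_wpM2l (ltW h0)); rewrite mulr1.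
rewrite -mulrA; move: (h * _) => z h1 h2.
have ij0 : t i < t j.
  by apply: le_lt_trans h2; rewrite lerDl mulr_ge0// (le_trans (ltW h0)).
rewrite ltr0_norm ?subr_lt0// opprB lerBrDl; apply: le_trans (ltW h2).
by rewrite lerD2l ler_wpM2l.
Qed.

Lemma admissible_mem t (i : 'I_n) : admissible a b h n t ->
  a <= t i - h /\ t i + h <= b.
Proof.
move=> adm; have [ta _ tb] := adm.
have n0 : (0 < n)%N by apply: leq_ltn_trans (ltn_ord i).
have n1 : (n.-1 < n)%N by rewrite prednK.
have := ta (Ordinal n0) erefl; have := tb (Ordinal n1) (prednK n0) => tb' ta'.
split.
  case: (posnP i) => i0; first exact: ta.
  have := @admissible_lt _ (Ordinal n0) i adm i0.
  have : 0 <= 2 * h * (i - Ordinal n0)%:R by rewrite !mulr_ge0 ?(ltW h0).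
  by move: (2 * h * _) => z; lra.
have : (i <= n.-1)%N by rewrite -ltnS prednK.
rewrite leq_eqVlt => /predU1P[iE|i1]; first by apply: tb; rewrite iE prednK.
have := @admissible_lt _ i (Ordinal n1) adm i1.
have : 0 <= 2 * h * (Ordinal n1 - i)%:R by rewrite !mulr_ge0 ?(ltW h0).
by move: (2 * h * _) => z; lra.
Qed.

(** Strictness comes from the gaps between consecutive intervals, hence only from two nodes on: a
    single interval may fill [[a, b]]. *)
Lemma admissible_length t : (0 < n)%N -> admissible a b h n t ->
  2 * n%:R * h <= b - a /\ ((1 < n)%N -> 2 * n%:R * h < b - a).
Proof.
move=> n0 adm; have n1 : (n.-1 < n)%N by rewrite prednK.
have [t0a _] := admissible_mem (Ordinal n0) adm.
have [_ tnb] := admissible_mem (Ordinal n1) adm.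
have nE : 2 * n%:R * h = 2 * h * n.-1%:R + 2 * h.
  by rewrite -{1}(prednK n0) (mulrSr 1); ring.
have lt_ba : (1 < n)%N -> 2 * n%:R * h < b - a.
  move=> n2; have := @admissible_lt _ (Ordinal n0) (Ordinal n1) adm.
  rewrite /= -ltnS prednK// => /(_ n2); rewrite nE subn0.
  by move: (2 * h * _) => z; lra.
split => //; have := n0; rewrite leq_eqVlt => /predU1P[n1E|/lt_ba/ltW//].
have n01 : Ordinal n0 = Ordinal n1 by apply: val_inj; rewrite /= -n1E.
have nR1 : n%:R = 1 :> R by rewrite -n1E.
by move: tnb; rewrite -n01 nR1; lra.
Qed.

Lemma admissible_midpoints t : (0 < n)%N -> admissible a b h n t ->
  admissible a b h n (midpoints a b n).
Proof.
move=> n0 adm; have [nh nh1] := admissible_length n0 adm.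
have nR0 : (0 : R) < n%:R by rewrite ltr0n.
set d := (b - a) / (2 * n%:R).
have hd : h <= d by rewrite ler_pdivlMr ?mulr_gt0// mulrC.
have bE : b = a + 2 * d * n%:R by rewrite /d; field; rewrite gt_eqF.
have mE (k : 'I_n) : midpoints a b n k = a + 2 * d * k%:R + d.
  by rewrite /midpoints (mulrSr 1 k) /d; field; rewrite gt_eqF.
split => [i i0|i j jE|i iE]; rewrite !mE.
- by rewrite i0; lra.
(* A successor [j] exists, so there are at least two nodes and the strict inequality applies. *)
- have hd1 : h < d.
    rewrite ltr_pdivlMr ?mulr_gt0// mulrC; apply: nh1.
    by apply: leq_trans (ltn_ord j); rewrite jE.
  by rewrite jE (mulrSr 1); lra.
- have -> : b = a + 2 * d * i%:R + d + d.
    rewrite bE; have -> : n%:R = i%:R + 1 :> R by rewrite -(mulrSr 1 i) iE.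
    by ring.
  by rewrite lerD2l.
Qed.

End admissible.

(** * Real functions with zero means and large integral *)

Section extremal_function.
Context {R : realType} {omega : R -> R}.
Hypotheses (om : modulus_of_continuity omega)
  (omc : concave_on `[0, +oo[ omega).
Notation mu := (@lebesgue_measure R).
Implicit Types (g : R -> R) (c k s x : R).
Variables (a b h : R) (n : nat) (t : 'I_n -> R).
Hypotheses (n0 : (0 < n)%N) (h0 : 0 < h) (adm : admissible a b h n t).

Let d := (b - a) / (2 * n%:R).
Let p := h / d.
Let Om := \int[mu]_(s in `[0, d]) omega s.
Let psi := extremal_profile omega p.

Let nR0 : (0 : R) < n%:R. Proof. by rewrite ltr0n. Qed.

Let hd : h <= d.
Proof.
rewrite ler_pdivlMr ?mulr_gt0// mulrC.
by have [] := admissible_length h0 n0 adm.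
Qed.

Let d0 : 0 < d. Proof. exact: lt_le_trans hd. Qed.
Let p0 : 0 < p. Proof. by rewrite divr_gt0. Qed.
Let pd : p * d = h. Proof. by rewrite divfK ?gt_eqF. Qed.
(** The lemmas [piece_incr] and [piece_decr] integrate over length [d / c]: slope [p^-1] gives the
    inner length [h], and [(1 - p)^-1], in [dqV], the outer length [d - h]. *)
Let dpV : d / p^-1 = h. Proof. by rewrite invrK mulrC pd. Qed.

Let Om_norm : \int[mu]_(s in `[0, d]) omega `|s| = Om.
Proof. by apply: eq_Rintegral_itv => s /andP[s0 _]; rewrite ger0_norm. Qed.

Let c_norm : continuous (fun s : R => omega `|s|).
Proof. exact: has_modulus_continuous (has_modulus_normr om). Qed.

Let c_norm_affine (u : R -> R) : continuous u -> continuous (fun s => omega `|u s|).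
Proof.
move=> cu s; apply: (continuous_comp (f := u) (g := fun r => omega `|r|)).
  exact: cu.
exact: c_norm.
Qed.

Let piece_incr g k c x : 0 < c ->
  (forall s, x <= s <= x + d / c -> g s = k * omega (c * (s - x))) ->
  \int[mu]_(s in `[x, x + d / c]) g s = k * (c^-1 * Om).
Proof.
move=> c0 gE; rewrite -Om_norm -(Rintegral_affine_incr x c_norm c0 (ltW d0)).
rewrite -RintegralZl//; last first.
  apply: continuous_integrable; apply: c_norm_affine => s.
  by apply: cvgM; [exact: cvg_cst|apply: cvgB; [exact: cvg_id|exact: cvg_cst]].
apply: eq_Rintegral_itv => s sx; rewrite gE// ger0_norm//.
by rewrite mulr_ge0 ?(ltW c0)// subr_ge0; case/andP: sx.
Qed.

Let piece_decr g k c x : 0 < c ->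
  (forall s, x - d / c <= s <= x -> g s = k * omega (c * (x - s))) ->
  \int[mu]_(s in `[x - d / c, x]) g s = k * (c^-1 * Om).
Proof.
move=> c0 gE; rewrite -Om_norm -(Rintegral_affine_decr x c_norm c0 (ltW d0)).
rewrite -RintegralZl//; last first.
  apply: continuous_integrable; apply: c_norm_affine => s.
  by apply: cvgM; [exact: cvg_cst|apply: cvgB; [exact: cvg_cst|exact: cvg_id]].
apply: eq_Rintegral_itv => s sx; rewrite gE// ger0_norm//.
by rewrite mulr_ge0 ?(ltW c0)// subr_ge0; case/andP: sx.
Qed.

Section proper.
Hypothesis p1 : p < 1.

Let q0 : 0 < 1 - p. Proof. by rewrite subr_gt0. Qed.
Let dqV : d / (1 - p)^-1 = d - h.
Proof. by rewrite invrK mulrC mulrBl mul1r pd. Qed.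

Let psi_modulus : has_modulus omega psi.
Proof. by apply: extremal_profile_modulus => //; rewrite p0. Qed.

Let psi_inner s : s <= 0 -> psi s = - p * omega (p^-1 * - s).
Proof.
rewrite /psi /extremal_profile; have [s0 s0'|_ _] := leP 0 s.
  have -> : s = 0 by apply/le_anti; rewrite s0 s0'.
  by rewrite oppr0 mul0r mulr0 !(modulus0 om) !mulr0.
by rewrite [RHS]mulNr [p^-1 * _]mulrC.
Qed.

Let psi_outer s : 0 <= s -> psi s = (1 - p) * omega ((1 - p)^-1 * s).
Proof. by move=> s0; rewrite /psi /extremal_profile s0 [_^-1 * _]mulrC. Qed.

Let bump s := psi (`|s| - h).

Let bump_modulus : has_modulus omega bump.
Proof.
apply: (has_modulus_comp om (u := fun s => `|s| - h)) => // s s'.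
by rewrite opprB addrA subrK; exact: ler_dist_dist.
Qed.

Let c_bump x : continuous (fun s : R => bump (s - x)).
Proof.
apply: (has_modulus_continuous om).
apply: (has_modulus_comp om (u := fun s => s - x)) bump_modulus => s s'.
by rewrite opprB addrA subrK.
Qed.

(** Each half contributes [- p * (p * Om)]. The value does not depend on [x], so one constant
    corrects the means at all nodes. *)
Let bump_inner x : \int[mu]_(s in `[x - h, x + h]) bump (s - x) =
  - (2 * p ^+ 2 * Om).
Proof.
have [h0' hd' d0'] : [/\ 0 < h, h <= d & 0 < d] by [].
rewrite (Rintegral_itv_split (y := x) (@c_bump x)); [|lra|lra].
have pV0 : 0 < p^-1 by rewrite invr_gt0.
have := @piece_incr (fun s => bump (s - x)) (- p) p^-1 (x - h) pV0.
rewrite dpV subrK => ->; last first.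
  move=> s /andP[s1 s2]; rewrite /bump ler0_norm ?subr_le0// psi_inner; last lra.
  by congr (_ * omega (_ * _)); lra.
have := @piece_decr (fun s => bump (s - x)) (- p) p^-1 (x + h) pV0.
rewrite dpV addrK => ->; last first.
  move=> s /andP[s1 s2]; rewrite /bump ger0_norm ?subr_ge0// psi_inner; last lra.
  by congr (_ * omega (_ * _)); lra.
by rewrite invrK; ring.
Qed.

(** The outer pieces contribute [2 * (1 - p) ^+ 2 * Om], and [(1 - p) ^+ 2 - p ^+ 2 = 1 - 2 * p]. *)
Let bump_cell x : \int[mu]_(s in `[x - d, x + d]) bump (s - x) =
  2 * (1 - 2 * p) * Om.
Proof.
have [h0' hd' d0'] : [/\ 0 < h, h <= d & 0 < d] by [].
rewrite (Rintegral_itv_split (y := x - h) (@c_bump x)); [|lra|lra].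
rewrite (Rintegral_itv_split (x := x - h) (y := x + h) (@c_bump x)); [|lra|lra].
rewrite bump_inner; have qV0 : 0 < (1 - p)^-1 by rewrite invr_gt0.
have := @piece_incr (fun s => bump (s - x)) (1 - p) (1 - p)^-1 (x + h) qV0.
rewrite dqV; have -> : x + h + (d - h) = x + d by lra.
move=> ->; last first.
  move=> s /andP[s1 s2]; rewrite /bump ger0_norm; last lra.
  by rewrite psi_outer; [congr (_ * omega (_ * _)); lra|lra].
have := @piece_decr (fun s => bump (s - x)) (1 - p) (1 - p)^-1 (x - h) qV0.
rewrite dqV; have -> : x - h - (d - h) = x - d by lra.
move=> ->; last first.
  move=> s /andP[s1 s2]; rewrite /bump ler0_norm; last lra.
  by rewrite psi_outer; [congr (_ * omega (_ * _)); lra|lra].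
by rewrite invrK; ring.
Qed.

(** The level reached at distance [d] from a node, where a cell of the equal partition ends. *)
Let A := psi (d - h).

(* A minimum of nonpositive numbers is at least their sum, so a function of the
   distance to the nearest t k, truncated at A, dominates the sum over k of the
   dips at t k. This bounds its integral from below without following the
   unequal gaps between the t k. *)
Let dip s : R := Num.min (bump s - A) 0.

Let c_dip x : continuous (fun s : R => dip (s - x)).
Proof.
apply: (has_modulus_continuous om); apply: has_modulus_min.
apply: has_modulusDcst.
apply: (has_modulus_comp om (u := fun s => s - x)) bump_modulus => s s'.
by rewrite opprB addrA subrK.
Qed.

Let psi_nd s s' : s <= s' -> psi s <= psi s'.
Proof. by apply: extremal_profile_nondecreasing => //; rewrite p0. Qed.

Let dip_outer s : d <= `|s| -> dip s = 0.
Proof.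
by move=> ds; apply/min_idPr; rewrite subr_ge0; apply: psi_nd; rewrite lerD2r.
Qed.

Let dip_inner s : `|s| <= d -> dip s = bump s - A.
Proof.
by move=> ds; apply/min_idPl; rewrite subr_le0; apply: psi_nd; rewrite lerD2r.
Qed.

Let ab : a <= b.
Proof.
have [nh _] := admissible_length h0 n0 adm.
by rewrite -subr_ge0; apply: le_trans nh; rewrite !mulr_ge0// ltW.
Qed.

(** The dip vanishes beyond distance [d] and is nonpositive, so a cell sticking out of [[a, b]] can
    only lose negative mass. *)
Let dip_integral x :
  2 * (1 - 2 * p) * Om - 2 * d * A <= \int[mu]_(s in `[a, b]) dip (s - x).
Proof.
have [h0' hd' d0'] : [/\ 0 < h, h <= d & 0 < d] by [].
have cc : continuous (fun _ : R => A) by move=> ?; exact: cst_continuous.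
have xd : x - d <= x + d by lra.
have -> : 2 * (1 - 2 * p) * Om - 2 * d * A =
    \int[mu]_(s in `[x - d, x + d]) dip (s - x).
  rewrite (@eq_Rintegral_itv _ _ (fun s => bump (s - x) - A)); last first.
    by move=> s /andP[s1 s2]; apply: dip_inner; rewrite ler_norml; lra.
  rewrite RintegralB//; [|exact: continuous_integrable|exact: continuous_integrable].
  by rewrite bump_cell Rintegral_itv_cst//; congr (_ - _); ring.
apply: Rintegral_le0_widen => //.
- by move=> s; rewrite /dip ge_min lexx orbT.
- by move=> s s1; apply: dip_outer; rewrite ler0_norm; lra.
- by move=> s s1; apply: dip_outer; rewrite ger0_norm; lra.
Qed.

Lemma extremal_function_proper : exists g, [/\ has_modulus omega g,
  forall k : 'I_n, \int[mu]_(s in `[t k - h, t k + h]) g s = 0 &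
  2 * n%:R * (1 - p) * Om <= \int[mu]_(s in `[a, b]) g s].
Proof.
have [h0' hd' d0'] : [/\ 0 < h, h <= d & 0 < d] by [].
have /choice[near_ nearP] : forall s, exists k : 'I_n, forall j,
    `|s - t k| <= `|s - t j|.
  move=> s; pose k0 := Ordinal n0.
  case: (arg_minP (fun k : 'I_n => `|s - t k|) (erefl : xpredT k0)) => k _ H.
  by exists k => j; exact: H.
(* As a minimum of distances to points this is 1-Lipschitz. *)
pose dist s := `|s - t (near_ s)|.
have dist1 s s' : `|dist s - dist s'| <= `|s - s'|.
  have H r r' : dist r - dist r' <= `|r - r'|.
    rewrite lerBlDr; apply: le_trans (nearP r (near_ r')) _.
    exact: ler_distD.
  by rewrite ler_norml lerNl opprB H distrC H.
pose phi s := psi (dist s - h).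
have phi_mod : has_modulus omega phi.
  apply: (has_modulus_comp om (u := fun s => dist s - h)) psi_modulus => s s'.
  by rewrite opprB addrA subrK.
have cphi := has_modulus_continuous om phi_mod.
(* Over length [2 * h] this constant integrates to [2 * p ^+ 2 * Om], the opposite of the value in
   [bump_inner]. *)
pose kappa := p ^+ 2 / h * Om.
have cc k : continuous (fun _ : R => k) by move=> ?; exact: cst_continuous.
exists (fun s => phi s + kappa); split; first exact: has_modulusDcst.
  move=> k; rewrite (@eq_Rintegral_itv _ _ (fun s => bump (s - t k) + kappa)); last first.
    move=> s /andP[s1 s2]; congr (psi (_ - h) + _); rewrite /dist.
    have sk : `|s - t k| <= h by rewrite ler_norml; lra.
    (* If another node is nearest, the separation [2 * h] forces both distances to be [h], so they
       still agree. *)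
    have [->//|nk] := eqVneq (near_ s) k.
    have := admissible_sep h0 adm nk; have := nearP s k.
    have := ler_distD s (t (near_ s)) (t k); rewrite (distrC _ s); lra.
  rewrite RintegralD//; [|exact: continuous_integrable|exact: continuous_integrable].
  by rewrite bump_inner Rintegral_itv_cst ?/kappa; [field; rewrite gt_eqF|lra].
rewrite RintegralD//; [|exact: continuous_integrable|exact: continuous_integrable].
rewrite Rintegral_itv_cst//.
have dipsum s : \sum_(k < n) dip (s - t k) <= phi s - A.
  rewrite (bigD1 (near_ s))//=.
  apply: (@le_trans _ _ (dip (s - t (near_ s)))); last first.
    by rewrite /dip ge_min lexx.
  by rewrite gerDl sumr_le0// => k _; rewrite /dip ge_min lexx orbT.
have sumI : n%:R * (2 * (1 - 2 * p) * Om - 2 * d * A) <=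
    \int[mu]_(s in `[a, b]) \sum_(k < n) dip (s - t k).
  rewrite Rintegral_itv_sum//.
  rewrite mulr_natl -[X in _ *+ X]card_ord -sumr_const.
  by apply: ler_sum => k _; exact: dip_integral.
have csum : continuous (fun s : R => \sum_(k < n) dip (s - t k)).
  by apply: continuous_big => [|k _]; [exact: add_continuous|exact: c_dip].
have cphiA := has_modulus_continuous om (has_modulusDcst (- A) phi_mod).
have := le_trans sumI (le_Rintegral_itv csum cphiA (fun s _ => dipsum s)).
rewrite RintegralB//; [|exact: continuous_integrable|exact: continuous_integrable].
rewrite Rintegral_itv_cst//.
have baE : b - a = 2 * d * n%:R by rewrite /d; field; rewrite gt_eqF.
have -> : kappa * (b - a) = 2 * n%:R * p * Om.
  by rewrite baE /kappa /p; field; rewrite !gt_eqF.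
(* The levels [A] cancel because [n] cells of length [2 * d] fill [[a, b]]; what remains per node is
   [2 * (1 - 2 * p) + 2 * p = 2 * (1 - p)] times [Om]. *)
rewrite baE lerBrDr => H; rewrite -lerBlDr; apply: le_trans _ H.
by rewrite le_eqVlt; apply/orP; left; apply/eqP; ring.
Qed.

End proper.

(** When [h = d] the profile would divide by [1 - p = 0], but the bound is then 0 and the zero
    function attains it. *)
Lemma extremal_function : exists g, [/\ has_modulus omega g,
  forall k : 'I_n, \int[mu]_(s in `[t k - h, t k + h]) g s = 0 &
  2 * n%:R * (1 - 2 * n%:R * h / (b - a)) * Om <= \int[mu]_(s in `[a, b]) g s].
Proof.
have [nh _] := admissible_length h0 n0 adm.
have ab : 0 < b - a by apply: lt_le_trans nh; rewrite !mulr_gt0.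
have -> : 2 * n%:R * h / (b - a) = p by rewrite /p /d; field; rewrite !gt_eqF.
have : p <= 1 by rewrite ler_pdivrMr ?mul1r.
rewrite le_eqVlt => /predU1P[->|/extremal_function_proper//].
exists (fun=> 0); split.
- by move=> s s'; rewrite subrr normr0; exact: (modulus_ge0 om).
- by move=> k; rewrite /Rintegral integral0.
- by rewrite subrr mulr0 mul0r /Rintegral integral0.
Qed.

End extremal_function.

(** * The lower bound *)

Lemma maxr0_sub (R : realDomainType) (r : R) : Num.max r 0 - Num.max (- r) 0 = r.
Proof. by case: (leP r 0) => r0; case: (leP (- r) 0) => r1; lra. Qed.

Section line.
Context {R : realType} {X : lspaceType R} {P : X -> X}.
Hypothesis Pc : convexifying P.
Notation mu := (@lebesgue_measure R).
Variables x y : X.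
Hypotheses (cx : convex_elt x) (cy : convex_elt y) (xy : x +s y = stheta).
Implicit Types (r u v e : R) (g : R -> R).

(* Since -1 *s x need not be the opposite of x, negative multiples are taken of
   the opposite y. *)
Definition line r : X := Num.max r 0 *s x +s Num.max (- r) 0 *s y.

Let D := mdist x stheta.

Lemma lineE u v : 0 <= u -> 0 <= v -> u *s x +s v *s y = line (u - v).
Proof.
have H r s : 0 <= r -> 0 <= s -> (r + s) *s x +s s *s y = r *s x.
  by move=> r0 s0; rewrite cx// -saddA -sscaleDr xy sscales0 sadds0.
have H' r s : 0 <= r -> 0 <= s -> s *s x +s (r + s) *s y = r *s y.
  by move=> r0 s0; rewrite cy// (saddC (r *s y)) saddA -sscaleDr xy sscales0 sadd0s.
move=> u0 v0; rewrite /line opprB; have [uv|vu] := leP u v.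
  rewrite (max_r (_ : u - v <= 0)) ?subr_le0// max_l ?subr_ge0// sscale0 sadd0s.
  by rewrite -[in LHS](subrK u v) H'// subr_ge0.
have {}vu := ltW vu.
rewrite max_l ?subr_ge0// (max_r (_ : v - u <= 0)) ?subr_le0// sscale0 sadds0.
by rewrite -[in LHS](subrK v u) H// subr_ge0.
Qed.

Lemma line0 : line 0 = stheta.
Proof. by rewrite /line oppr0 maxxx !sscale0 sadds0. Qed.

Lemma lineD u v : line (u + v) = line u +s line v.
Proof.
rewrite {2 3}/line saddACA -cx ?le_max ?lexx ?orbT//.
rewrite -cy ?le_max ?lexx ?orbT// lineE ?addr_ge0 ?le_max ?lexx ?orbT//.
by congr line; rewrite opprD addrACA !maxr0_sub.
Qed.

Lemma lineZ r u : 0 <= r -> r *s line u = line (r * u).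
Proof.
move=> r0; rewrite {1}/line sscaleDr !sscaleA.
by rewrite lineE ?mulr_ge0 ?le_max ?lexx ?orbT// -mulrBr maxr0_sub.
Qed.

Lemma line_convexifying r : P (line r) = line r.
Proof.
by rewrite (convexifyingD Pc) !(convexifyingZ Pc) !(convexifying_id Pc).
Qed.

(** Translations along the line are isometries. They reduce both signs of [u - v] to a nonnegative
    multiple of [x] against [stheta], where the metric is homogeneous. *)
Lemma line_dist u v : mdist (line u) (line v) = `|u - v| * D.
Proof.
have inv r : invertible_elt (line r).
  by exists (line (- r)); rewrite -lineD subrr line0.
rewrite -(invertible_isometry _ _ (inv (- v))) -!lineD subrr line0.
move: (u - v) => r; have [r0|/ltW r0] := leP 0 r.
  rewrite /line max_l// max_r ?oppr_le0// sscale0 sadds0.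
  by rewrite -(sscales0 r) mdist_sscale.
rewrite -(invertible_isometry _ _ (inv (- r))) -lineD subrr line0 sadd0s.
rewrite /line max_l ?oppr_ge0// opprK max_r// sscale0 sadds0.
by rewrite -(sscales0 (- r)) mdist_sscale normrN metric_sym.
Qed.

(** One subdivision yields both a simple approximation of [line \o g] and a Riemann sum [r] of
    [g]. *)
Lemma approx_line g c d e : c <= d -> continuous g ->
  (forall e' : R, 0 < e' -> exists2 eta : R, 0 < eta &
    forall s t : R, `|s - t| <= eta -> `|g s - g t| <= e') ->
  0 < e -> exists2 r, approx_integral P `]c, d] (line \o g) (e * D) (line r) &
    `|r - \int[mu]_(t in `[c, d]) g t| <= e * (d - c).
Proof.
move=> cd cg ug e0; have [eta eta0 ge] := ug e e0.
have D0 : 0 <= D by exact: mdist_ge0.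
apply: (interval_ind (Q := fun c d => exists2 r,
  approx_integral P `]c, d] (line \o g) (e * D) (line r) &
    `|r - \int[mu]_(t in `[c, d]) g t| <= e * (d - c)) eta0 cd).
  move=> x1 x2 x3 _ x12 x23 _ [r fr rI] [s fs sI]; exists (r + s).
    by rewrite lineD; exact: approx_itvU fr fs.
  rewrite (Rintegral_itv_split cg x12 x23) opprD addrACA.
  apply: le_trans (ler_normD _ _) _; apply: le_trans (lerD rI sI) _.
  by rewrite -mulrDr ler_wpM2l ?(ltW e0)//; lra.
move=> x1 x2 _ x12 _ x12e.
have gd s t : x1 <= s <= x2 -> x1 <= t <= x2 -> `|g s - g t| <= e.
  by move=> ? ?; apply: ge; rewrite ler_norml; lra.
have cc (k : R) : continuous (fun _ : R => k) by move=> ?; exact: cst_continuous.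
exists ((x2 - x1) * g x2).
  rewrite -lineZ ?subr_ge0// -(line_convexifying (g x2)).
  apply: approx_itv_cst => // s s1 s2 /=; rewrite line_dist ler_wpM2r//.
  by apply: gd; rewrite ?s2 ?(ltW s1)// x12 lexx.
have gI k : (x2 - x1) * g x2 + k * (x2 - x1) = \int[mu]_(t in `[x1, x2]) (g x2 + k).
  by rewrite Rintegral_itv_cst// mulrC -mulrDl.
have gx2 t : x1 <= t <= x2 -> g x2 + - e <= g t <= g x2 + e.
  move=> x1t; have := gd t x2 x1t; rewrite x12 lexx => /(_ isT).
  by rewrite ler_distl.
have l : (x2 - x1) * g x2 + - e * (x2 - x1) <= \int[mu]_(t in `[x1, x2]) g t.
  by rewrite gI; apply: le_Rintegral_itv => // t /gx2/andP[].
have u : \int[mu]_(t in `[x1, x2]) g t <= (x2 - x1) * g x2 + e * (x2 - x1).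
  by rewrite gI; apply: le_Rintegral_itv => // t /gx2/andP[].
by rewrite distrC ler_distl u -mulNr l.
Qed.

Lemma Xintegral_line g c d : c <= d -> continuous g ->
  (forall e' : R, 0 < e' -> exists2 eta : R, 0 < eta &
    forall s t : R, `|s - t| <= eta -> `|g s - g t| <= e') ->
  Xintegral P `[c, d] (line \o g) = line (\int[mu]_(t in `[c, d]) g t).
Proof.
move=> cd cg ug; have D0 : 0 <= D by exact: mdist_ge0.
apply: mdist_positivity; apply/le_anti; rewrite mdist_ge0 andbT.
apply/ler_addgt0Pl => /= e e0; rewrite addr0.
have dc0 : 0 <= d - c by rewrite subr_ge0.
(* The approximation in [X] and the Riemann sum each cost [e' * D * (d - c)]; the added 1 keeps the
   denominator positive. *)
pose e' := e / (1 + 2 * D * (d - c)).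
have den0 : 0 < 1 + 2 * D * (d - c) by rewrite ltr_pwDl// !mulr_ge0.
have e'0 : 0 < e' by rewrite divr_gt0.
have [r fr rI] := approx_line cd cg ug e'0.
have uc : uniformly_continuous_on c d (line \o g).
  move=> e1 e10; have e1D : 0 < e1 / (1 + D) by rewrite divr_gt0// ltr_pwDl.
  have [eta eta0 geta] := ug _ e1D; exists eta => // s t _ _ st /=.
  rewrite line_dist; apply: (@le_trans _ _ (e1 / (1 + D) * (1 + D))).
    by apply: ler_pM => //; [exact: geta|rewrite lerDr].
  by rewrite divfK// gt_eqF// ltr_pwDl.
apply: le_trans (metric_triangle _ (line r) _) _.
rewrite line_dist.
apply: le_trans (lerD (Xintegral_itv_dist Pc cd uc (mulr_ge0 (ltW e'0) D0) fr)
  (lexx _)) _.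
apply: (@le_trans _ _ (e' * D * (d - c) + e' * (d - c) * D)).
  by rewrite lerD2l ler_wpM2r.
have -> : e = e' * (1 + 2 * D * (d - c)) by rewrite divfK ?gt_eqF.
rewrite -subr_ge0.
have -> : e' * (1 + 2 * D * (d - c)) - (e' * D * (d - c) + e' * (d - c) * D) = e'.
  by ring.
exact: ltW.
Qed.

End line.

Section lower_bound.
Context {R : realType} {X : lspaceType R} {P : X -> X} {omega : R -> R}.
Hypotheses (Pc : convexifying P) (om : modulus_of_continuity omega)
  (omc : concave_on `[0, +oo[ omega).
Hypothesis X_nontrivial :
  exists2 x : X, (invertible_elt `&` convex_elt) x & x <> stheta.
Notation mu := (@lebesgue_measure R).

(** Two opposite functions on the line have information constantly [stheta], so a method gives both
    the same answer, while their integrals are at least [2 * opt] apart. *)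
Lemma recovery_error_ge (a b h : R) n (t : 'I_n -> R) : (0 < n)%N -> 0 < h ->
  admissible a b h n t ->
  ((2 * n%:R * (1 - 2 * n%:R * h / (b - a)) *
    \int[mu]_(t in `[0, (b - a) / (2 * n%:R)]) omega t)%:E <=
  recovery_error (Xintegral P `[a, b]) (Hclass omega a b) (mean_info P h n t))%E.
Proof.
move=> n0 h0 adm; set opt := 2 * n%:R * _ * _.
have [x [[x' xx'] cx] xN0] := X_nontrivial.
(* The inverse of [x] is replaced by its image under [P], which is convex and still inverse to [x],
   as [P x = x]. *)
have xy : x +s P x' = stheta.
  by rewrite -{1}(convexifying_id Pc cx) -(convexifyingD Pc) xx' (convexifying_theta Pc).
have cy : convex_elt (P x') by exact: (convex_convexifying Pc).
pose D := mdist x stheta; pose L := line x (P x').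
have D0 : 0 < D by rewrite mdist_gt0; exact/eqP.
have [g [gom g0 gopt]] := extremal_function om omc n0 h0 adm.
have [nh _] := admissible_length h0 n0 adm.
have ab : a <= b by rewrite -subr_ge0; apply: le_trans nh; rewrite !mulr_ge0// ltW.
have cg := has_modulus_continuous om gom.
(* The values of [c] will be [D^-1] and [- D^-1], which compensate the factor [D] in [line_dist]. *)
pose f (c : R) := L \o (fun s => c * g s).
have fI (c c1 c2 : R) : c1 <= c2 ->
    Xintegral P `[c1, c2] (f c) = L (c * \int[mu]_(s in `[c1, c2]) g s).
  move=> c12; rewrite -RintegralZl//; last exact: continuous_integrable.
  apply: (Xintegral_line Pc cx cy xy c12).
    by move=> s; apply: cvgM; [exact: cvg_cst|exact: cg].
  move=> e e0; have e'0 : 0 < e / (1 + `|c|) by rewrite divr_gt0// ltr_pwDl.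
  have [eta eta0 ome] := modulus_small om e'0; exists eta => // s s' ss'.
  rewrite -mulrBr normrM.
  apply: (@le_trans _ _ ((1 + `|c|) * (e / (1 + `|c|)))); last first.
    by rewrite mulrC divfK// gt_eqF// ltr_pwDl.
  apply: ler_pM => //; first by rewrite lerDr.
  by apply: le_trans (gom _ _) (le_trans _ ome); exact: (modulus_nondecreasing om).
have fH (c : R) : `|c| * D = 1 -> Hclass omega a b (f c).
  move=> cD s s' _ _; rewrite /f /= (line_dist cx cy xy) -mulrBr normrM.
  by rewrite mulrAC cD mul1r.
have fi (c : R) : mean_info P h n t (f c) = fun=> stheta.
  apply/funext => k; rewrite /mean_info fI; last lra.
  by rewrite g0 mulr0 /L line0 sscales0.
have absV : `|D^-1| * D = 1 by rewrite gtr0_norm ?invr_gt0// mulVf// gt_eqF.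
have absNV : `|- D^-1| * D = 1 by rewrite normrN.
apply: le_ereal_inf_tmp => _ [Phi _ <-].
have errP c : Hclass omega a b (f c) ->
    ((mdist (Xintegral P `[a, b] (f c)) (Phi (fun=> stheta)))%:E <=
     method_error (Xintegral P `[a, b]) (Hclass omega a b) (mean_info P h n t) Phi)%E.
  by move=> fc; apply: ereal_sup_ubound; exists (f c) => //; rewrite fi.
have e1 := errP _ (fH _ absV); have e2 := errP _ (fH _ absNV).
set z := Phi _ in e1 e2.
have : 2 * opt <= mdist (Xintegral P `[a, b] (f D^-1)) z
    + mdist (Xintegral P `[a, b] (f (- D^-1))) z.
  rewrite [X in _ + X]metric_sym; apply: le_trans (metric_triangle _ _ _).
  rewrite !fI// (line_dist cx cy xy) -/D; set J := \int[mu]_(s in `[a, b]) g s in gopt *.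
  have -> : D^-1 * J - - D^-1 * J = 2 * J / D by field; rewrite gt_eqF.
  rewrite -{2}(ger0_norm (ltW D0)) -normrM divfK ?gt_eqF//.
  by apply: le_trans (ler_norm _); rewrite ler_wpM2l.
(* One of the two errors is at least half of their sum. *)
have [le1 _|lt1 le12] := leP opt (mdist (Xintegral P `[a, b] (f D^-1)) z).
  by apply: le_trans e1; rewrite lee_fin.
by apply: le_trans e2; rewrite lee_fin; lra.
Qed.

End lower_bound.

Theorem theorem4 (R : realType) (X : lspaceType R)
    (X_nontrivial : exists2 x : X, (invertible_elt `&` convex_elt) x & x <> stheta)
    (P : X -> X) (P_convexifying : convexifying P)
    (omega : R -> R) (omega_modulus : modulus_of_continuity omega)
    (omega_concave : concave_on `[0, +oo[ omega)
    (a b h : R) (n : nat) (n_gt0 : (0 < n)%N) (h_gt0 : 0 < h)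
    (ex_admissible : exists t : 'I_n -> R, admissible a b h n t) :
  let W : set (R -> X) := Hclass omega a b in
  let Lambda : (R -> X) -> X := Xintegral P `[a, b] in
  let I : ('I_n -> R) -> (R -> X) -> ('I_n -> X) := mean_info P h n in
  let tstar : 'I_n -> R := midpoints a b n in
  let Phistar : ('I_n -> X) -> X := mean_method a b n in
  let opt : R :=
    2 * n%:R * (1 - 2 * n%:R * h / (b - a)) *
    \int[lebesgue_measure]_(t in `[0, (b - a) / (2 * n%:R)]) omega t in
  [/\ ereal_inf [set recovery_error Lambda W (I t) | t in admissible a b h n]
        = opt%:E,
      admissible a b h n tstar,
      recovery_error Lambda W (I tstar) = opt%:E
    & method_error Lambda W (I tstar) Phistar = opt%:E].
Proof.
move=> W Lambda I tstar Phistar opt.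
have [t0 adm0] := ex_admissible.
have [nh _] := admissible_length h_gt0 n_gt0 adm0.
have adm := admissible_midpoints h_gt0 n_gt0 adm0.
have lower t : admissible a b h n t -> (opt%:E <= recovery_error Lambda W (I t))%E.
  exact: recovery_error_ge.
have upper : (method_error Lambda W (I tstar) Phistar <= opt%:E)%E.
  apply: ge_ereal_sup => _ [f Wf <-]; rewrite lee_fin.
  exact: midpoints_error.
(* This closes the chain [opt <= recovery_error <= method_error <= opt] at the midpoints. *)
have rec_le : (recovery_error Lambda W (I tstar) <= method_error Lambda W (I tstar) Phistar)%E.
  by apply: ereal_inf_lbound; exists Phistar.
split => //.
- apply/le_anti/andP; split; last by apply: le_ereal_inf_tmp => _ [t /lower ? <-].
  apply: le_trans upper; apply: le_trans rec_le.
  by apply: ereal_inf_lbound; exists tstar.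
- by apply/le_anti/andP; split; [exact: le_trans rec_le upper|exact: lower].
- apply/le_anti/andP; split => //; exact: le_trans (lower _ adm) rec_le.
Qed.
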